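(* Let $1\le p\le\infty$. The minimum of $\delta_p(\alpha)$ over all irrational $\alpha\in\mathbb{R}$ equals $\Delta_p$ when $1\le p\le 2$, and equals \[ \tfrac{\Delta_p}{10}\left(\sqrt{5}+5\right)\left(\left(\tfrac12(\sqrt5-1)\right)^p+1\right)^{2/p} \] when $2<p\le\infty$ (for $p=\infty$ the factor $\left(\left(\tfrac12(\sqrt5-1)\right)^p+1\right)^{2/p}$ is read as its limit $1$). For $2<p\le\infty$ this value is attained at $\alpha=\frac{-1+\sqrt5}{2}$.
   Context: For $1\le p<\infty$ the $p$-norm on $\mathbb{R}^2$ is $F^{\langle p\rangle}(x,y)=(|x|^p+|y|^p)^{1/p}$, and $F^{\langle\infty\rangle}(x,y)=\max(|x|,|y|)$. For a norm $F$ and $t>0$ put $F_t(x,y)=F(t^{-1}x,ty)$. Let $\Delta_p$ be the minimal area of a parallelogram with one vertex at the origin and the other three vertices on the boundary of the unit ball $\{P:F^{\langle p\rangle}(P)<1\}$. For irrational $\alpha$, $\delta_p(\alpha)$ denotes the largest real number with the following property: if $c>\delta_p(\alpha)$ then for every sufficiently large real $t$ there exist integers $a,q$ with $q>0$ and $\Delta_p\,F^{\langle p\rangle}_t(q,a-\alpha q)^2<c$, while if $c<\delta_p(\alpha)$ there are arbitrarily large $t$ for which no such $a,q$ exist. *)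

(* Defs.v *)
From HB Require Import structures.
From mathcomp Require Import all_boot all_order all_algebra.
From mathcomp Require Import all_classical all_reals all_analysis.

Set Implicit Arguments.
Unset Strict Implicit.
Unset Printing Implicit Defensive.

Import Order.TTheory GRing.Theory Num.Theory.
Import numFieldNormedType.Exports.

Local Open Scope classical_set_scope.
Local Open Scope ring_scope.

Section Definitions.
Variable R : realType.
Implicit Types (F : R * R -> R) (p : \bar R) (alpha c d t : R).

(* The exponent ranges over [1, +oo]; the value at -oo is never used. *)
Definition pnorm p (P : R * R) : R :=
  match p with
  | r%:E => (`|P.1| `^ r + `|P.2| `^ r) `^ r^-1
  | +oo%E => Num.max `|P.1| `|P.2|
  | -oo%E => 0
  end.

Definition rescale F t (P : R * R) : R := F (t^-1 * P.1, t * P.2).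

Definition unit_ball F : set (R * R) := [set P | F P < 1].

Definition boundary (A : set (R * R)) : set (R * R) := closure A `\` A°.

(* Signed area of the parallelogram with vertices 0, P, P + Q, Q. *)
Definition cross (P Q : R * R) : R := P.1 * Q.2 - P.2 * Q.1.

Definition inscribed_areas F : set R :=
  [set s | exists P Q : R * R,
     [/\ cross P Q != 0,
         boundary (unit_ball F) P,
         boundary (unit_ball F) Q,
         boundary (unit_ball F) (P + Q) &
         s = `|cross P Q| ]].

Definition Delta p : R := inf (inscribed_areas (pnorm p)).

Definition approximable p alpha c t : Prop :=
  exists a q : int,
    0 < q /\
    Delta p * rescale (pnorm p) t (q%:~R, a%:~R - alpha * q%:~R) ^+ 2 < c.

Definition dirichlet_threshold p alpha d : Prop :=
  (forall c, d < c -> \forall t \near +oo, approximable p alpha c t) /\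
  (forall c, c < d -> forall T : R, exists2 t, T < t & ~ approximable p alpha c t).

(* At most one d satisfies dirichlet_threshold, so the supremum is the largest
   such d. *)
Definition delta p alpha : R := sup [set d | dirichlet_threshold p alpha d].

Definition is_minimum (A : set R) (m : R) : Prop := A m /\ lbound A m.

Definition golden : R := (-1 + Num.sqrt 5) / 2.

(* (golden^p + 1)^(2/p), with its limit 1 at p = +oo. *)
Definition golden_factor p : R :=
  match p with
  | r%:E => ((2^-1 * (Num.sqrt 5 - 1)) `^ r + 1) `^ (2 / r)
  | +oo%E => 1
  | -oo%E => 0
  end.

End Definitions.

Arguments golden {R}.

(* Main.v *)
(** Up to the factor [Delta p], [delta p alpha] is the limsup over [t] of the
    least value of [F_t(v)^2] on the lattice vectors [v = (q, a - alpha q)].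

    Lower bound.  Take consecutive convergents [v0, v1] of [alpha], with
    denominators [q0 <= q1] and errors [E1 < E0], so that
    [q1 E0 + q0 E1 = 1].  For [q1 <= t <= 1 / E0] every lattice vector which is
    not a multiple of [v0] or [v1] has [F_t >= 1], so only [v0] and [v1] matter.
    For the [t] at which [F_t(v0) = F_t(v1)], Cauchy-Schwarz bounds the common
    value of [F_t^2] below by [((q1 E0)^(p/2) + (q0 E1)^(p/2))^(2/p)]; when this
    [t] lies outside the interval, an endpoint gives [F_t >= 1].  For [p <= 2]
    the bound is at least 1.  For [p > 2] it increases with [q1 E0 >= 1/2], and
    among any three consecutive pairs of convergents one has
    [q1 E0 >= (5 + sqrt 5) / 10].

    Upper bound.  For [p <= 2] the value 1 is attained by any [alpha] whose
    partial quotients tend to infinity, for instance [0; 1, 2, 3, ...].  For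
    [p > 2] the Fibonacci vectors show that the golden ratio attains the bound. *)

Require Import Defs.
From HB Require Import structures.
From mathcomp Require Import all_boot all_order all_algebra.
From mathcomp Require Import all_classical all_reals all_analysis.
From mathcomp Require Import ring lra zify.

Set Implicit Arguments.
Unset Strict Implicit.
Unset Printing Implicit Defensive.

Import Order.TTheory GRing.Theory Num.Theory.
Import numFieldNormedType.Exports.

Local Open Scope classical_set_scope.
Local Open Scope ring_scope.

(** * Thresholds *)

Section Threshold.
Context {R : realType}.
Implicit Types (p : \bar R) (alpha c d t k e : R).

Definition approx_norm p alpha t (a q : int) : R :=
  rescale (pnorm p) t (q%:~R, a%:~R - alpha * q%:~R).

(** Upper half of a limsup statement, with [frequently_above] as the lower half. The factor
    [Delta p] is left out of both, so its value is never computed; the transfer to [delta] uses only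
    that it is nonnegative. *)
Definition eventually_below p alpha k : Prop :=
  forall e, 0 < e -> \forall t \near +oo,
    exists a q : int, 0 < q /\ approx_norm p alpha t a q ^+ 2 < k + e.

Definition frequently_above p alpha k : Prop :=
  forall T : R, exists2 t, T < t &
    forall a q : int, 0 < q -> k <= approx_norm p alpha t a q ^+ 2.

Lemma Delta_ge0 p : 0 <= Delta p.
Proof.
(* An empty set of areas has infimum 0 by convention. *)
have [E|/eqP/set0P ne] := pselect (inscribed_areas (pnorm p) = set0).
  by rewrite /Delta E inf0.
by apply: lb_le_inf => // s [P [Q [_ _ _ _ ->]]].
Qed.

(** A constant strictly between two thresholds would work for all large [t] and fail for arbitrarily
    large [t]. Applied in both directions, this gives uniqueness. *)
Lemma dirichlet_threshold_le p alpha d d' :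
  dirichlet_threshold p alpha d -> dirichlet_threshold p alpha d' -> d <= d'.
Proof.
move=> [_ hd] [hd' _]; rewrite leNgt; apply/negP => lt_d'd.
have [c /andP[c1 c2]] : exists c, d' < c < d.
  by exists ((d + d') / 2); apply/andP; split; lra.
have [T [_ hT]] := hd' _ c1.
by have [t Tt] := hd _ c2 T; apply; apply: hT.
Qed.

Lemma delta_eq p alpha d : dirichlet_threshold p alpha d -> delta p alpha = d.
Proof.
move=> hd; rewrite /delta (_ : [set _ | _] = [set d]) ?sup1//.
apply/seteqP; split => [x hx|x ->//].
by apply/eqP; rewrite eq_le !(@dirichlet_threshold_le p alpha).
Qed.

Lemma approximable_below {p alpha k c} : eventually_below p alpha k ->
  Delta p * k < c -> \forall t \near +oo, approximable p alpha c t.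
Proof.
move=> hk kc; have D0 := Delta_ge0 p.
have D1 : 0 < Delta p + 1 by lra.
(* The denominator [Delta p + 1] makes [Delta p * e] smaller than [c - Delta p * k] even if
   [Delta p] is 0. *)
have e0 : 0 < (c - Delta p * k) / (Delta p + 1) by apply: divr_gt0; lra.
have [T [Tr hT]] := hk _ e0; exists T; split => // t /hT [a [q [q0 hq]]].
exists a, q; split => //; rewrite -/(approx_norm p alpha t a q).
apply: (le_lt_trans (ler_wpM2l D0 (ltW hq))).
rewrite mulrDr -ltrBrDl mulrCA gtr_pMr ?subr_gt0//.
by rewrite ltr_pdivrMr// mul1r; lra.
Qed.

(** The threshold is the infimum of the constants that work for all large [t]. They exist by the
    hypothesis and are bounded below by 0, since the approximation quantity is nonnegative. *)
Lemma delta_threshold {p alpha k} : eventually_below p alpha k ->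
  dirichlet_threshold p alpha (delta p alpha).
Proof.
move=> hk.
pose S := [set c | \forall t \near +oo, approximable p alpha c t].
have S0 : S !=set0.
  by exists (Delta p * k + 1); apply: (approximable_below hk); lra.
have lbS : has_lbound S.
  exists 0 => c [T [_ hT]]; have [|a [q [_]]] := hT (T + 1); first lra.
  by move=> /ltW; apply: le_trans; rewrite mulr_ge0 ?Delta_ge0// sqr_ge0.
suff hd : dirichlet_threshold p alpha (inf S) by rewrite (delta_eq hd).
split=> [c Sc|c cS T].
  have [c' [T [Tr hT]] c'c] := inf_lt S0 Sc.
  exists T; split => // t /hT [a [q [q0 h]]]; exists a, q; split => //.
  exact: lt_trans c'c.
apply: contrapT => h; suff : S c by move=> /(ge_inf lbS); rewrite leNgt cS.
exists T; split; first by rewrite num_real.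
by move=> t Tt; apply: contrapT => ht; apply: h; exists t.
Qed.

Lemma delta_le p alpha k : eventually_below p alpha k ->
  delta p alpha <= Delta p * k.
Proof.
move=> hk; have [_ h2] := delta_threshold hk.
rewrite leNgt; apply/negP => lt_kd.
have [c /andP[c1 c2]] : exists c, Delta p * k < c < delta p alpha.
  by exists ((Delta p * k + delta p alpha) / 2); apply/andP; split; lra.
have [T [_ hT]] := approximable_below hk c1.
by have [t Tt] := h2 _ c2 T; apply; apply: hT.
Qed.

(** The bound [k'] guarantees that a threshold exists, so that [delta] is not the default value of a
    supremum. *)
Lemma delta_ge p alpha k k' : eventually_below p alpha k' ->
  frequently_above p alpha k -> Delta p * k <= delta p alpha.
Proof.
move=> /delta_threshold [h1 _] hk.
rewrite leNgt; apply/negP => /h1 [T [_ hT]].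
have [t Tt ht] := hk T; have [a [q [q0]]] := hT t Tt.
rewrite -/(approx_norm p alpha t a q) ltNge => /negP; apply.
by rewrite ler_wpM2l ?Delta_ge0// ht.
Qed.

End Threshold.

(** * The p-norms *)

Section Pnorm.
Context {R : realType}.
Implicit Types (p : \bar R) (x y r s u w : R).

Lemma ler_powR2 r x y : 0 <= r -> 0 <= x -> x <= y -> x `^ r <= y `^ r.
Proof. by move=> r0 x0 xy; apply: ge0_ler_powR; rewrite ?nnegrE// (le_trans x0). Qed.

Lemma powRK r x : r != 0 -> 0 <= x -> (x `^ r) `^ r^-1 = x.
Proof. by move=> r0 x0; rewrite -powRrM divff// powRr1. Qed.

Lemma powRVK r x : r != 0 -> 0 <= x -> (x `^ r^-1) `^ r = x.
Proof. by move=> r0 x0; rewrite -powRrM mulVf// powRr1. Qed.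

Lemma pnorm_ge0 p (P : R * R) : 0 <= pnorm p P.
Proof.
by case: p => [r| |] /=; rewrite ?powR_ge0// le_max normr_ge0.
Qed.

Lemma pnorm_ge_l p (P : R * R) : (1 <= p)%E -> `|P.1| <= pnorm p P.
Proof.
case: p => [r| |] //=; last by rewrite le_max lexx.
rewrite lee_fin => r1.
have r0 : 0 < r by lra.
rewrite -{1}(@powRK r `|P.1|) ?gt_eqF//.
by apply: ler_powR2; rewrite ?invr_ge0 ?powR_ge0 ?lerDl ?powR_ge0 ?ltW.
Qed.

Lemma pnorm_ge_r p (P : R * R) : (1 <= p)%E -> `|P.2| <= pnorm p P.
Proof.
case: p => [r| |] //=; last by rewrite le_max lexx orbT.
rewrite lee_fin => r1.
have r0 : 0 < r by lra.
rewrite -{1}(@powRK r `|P.2|) ?gt_eqF//.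
by apply: ler_powR2; rewrite ?invr_ge0 ?powR_ge0 ?lerDr ?powR_ge0 ?ltW.
Qed.

Lemma le_pnorm p (P Q : R * R) : (1 <= p)%E ->
  `|P.1| <= `|Q.1| -> `|P.2| <= `|Q.2| -> pnorm p P <= pnorm p Q.
Proof.
case: p => [r| |] /=; [|move=> _ h1 h2|by []]; last first.
  by rewrite ge_max !le_max h1 h2 orbT.
rewrite lee_fin => r1 h1 h2.
have r0 : 0 <= r by lra.
apply: ler_powR2; rewrite ?invr_ge0 ?addr_ge0 ?powR_ge0//.
by apply: lerD; apply: ler_powR2.
Qed.

Lemma pnormZ p x (P : R * R) : (1 <= p)%E -> 0 <= x ->
  pnorm p (x * P.1, x * P.2) = x * pnorm p P.
Proof.
case: p => [r| |] /=; [|move=> _ x0|by []]; last first.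
  by rewrite !normrM (ger0_norm x0) maxr_pMr.
rewrite lee_fin => r1 x0.
rewrite !normrM (ger0_norm x0) !powRM// -mulrDr powRM ?powR_ge0//.
by rewrite powRK// gt_eqF//; lra.
Qed.

(** With [A] and [B] the [r]-th powers of the coordinates, both in [0, 1], [(1 - A) * (1 - B) >= 0]
    gives [A + B <= 1 + A * B <= 1 + u], which is at most [(1 + u) ^ r]. *)
Lemma pnorm_le_thin p x y u : (1 <= p)%E ->
  `|x| <= 1 -> `|y| <= 1 -> `|x| * `|y| <= u -> u <= 1 -> pnorm p (x, y) <= 1 + u.
Proof.
move=> p1 x1 y1 xyu u1; have u0 : 0 <= u by apply: le_trans xyu; rewrite mulr_ge0.
move: p p1 => [r| |] //=; last by rewrite ge_max; lra.
rewrite lee_fin => r1; have r0 : 0 < r by lra.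
rewrite -[leRHS](@powRK r) ?gt_eqF//; last lra.
apply: ler_powR2; rewrite ?invr_ge0 ?addr_ge0 ?powR_ge0//; first lra.
have uu : 1 + u <= (1 + u) `^ r by apply: le1r_powR; lra.
apply: le_trans uu.
have le1 (z : R) : `|z| <= 1 -> `|z| `^ r <= 1.
  move=> z1; rewrite (_ : 1 = 1 `^ r); last by rewrite powR1.
  by apply: ler_powR2 => //; lra.
have := le1 _ x1; have := le1 _ y1.
have : (`|x| * `|y|) `^ r <= u.
  apply: (@le_trans _ _ (u `^ r)); first by apply: ler_powR2; rewrite ?mulr_ge0//; lra.
  move: u0; rewrite le_eqVlt => /orP[/eqP <-|u0]; first by rewrite powR0// gt_eqF.
  by apply: ge1r_powR => //; rewrite u0.
rewrite powRM//.
move: (powR_ge0 `|x| r) (powR_ge0 `|y| r).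
set A := _ `^ _; set B := _ `^ _; nra.
Qed.

(** Convexity: [u0] and [1 - u0] are convex combinations of [u] and [1 - u] with exchanged weights
    [l] and [1 - l]. Adding the two convexity inequalities eliminates the weights. The formula for
    [l] divides by [2 * u - 1], hence the separate case [u = 1/2]. *)
Lemma powR_sum_spread s u u0 : 1 <= s -> 2^-1 <= u0 -> u0 <= u -> u <= 1 ->
  u0 `^ s + (1 - u0) `^ s <= u `^ s + (1 - u) `^ s.
Proof.
move=> s1 h0 h1 h2.
have [uh|uh] := eqVneq u 2^-1.
  by have -> : u0 = u by lra.
have uh' : 0 < 2 * u - 1 by rewrite lt_neqAle; apply/andP; split; [lra|lra].
pose l := (u0 + u - 1) / (2 * u - 1).
have l01 : 0 <= l <= 1.
  by rewrite divr_ge0 ?ler_pdivrMr//=; [lra|lra|lra].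
have lE : l * (2 * u - 1) = u0 + u - 1 by rewrite divfK// gt_eqF.
have H (v : R) : 0 <= v <= 1 ->
    (l * v + (1 - l) * (1 - v)) `^ s <= l * v `^ s + (1 - l) * (1 - v) `^ s.
  move=> v01; case/andP: l01 => l0 l1.
  have := convex_powR s1 (Itv01 l0 l1) (x := v) (y := 1 - v).
  rewrite !inE/= !in_itv/= !andbT; apply; lra.
have := H u; have := H (1 - u).
rewrite (_ : l * u + _ = u0); last lra.
rewrite (_ : l * (1 - u) + _ = 1 - u0); last lra.
rewrite (_ : 1 - (1 - u) = u); last lra.
have u01 : 0 <= u <= 1 by lra.
have u01' : 0 <= 1 - u <= 1 by lra.
by move=> /(_ u01') A /(_ u01) B; lra.
Qed.

Lemma powR_sum_le1 s u : 1 <= s -> 0 < u < 1 -> u `^ s + (1 - u) `^ s <= 1.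
Proof.
move=> s1 u01.
have A : u `^ s <= u by apply: ge1r_powR => //; lra.
have B : (1 - u) `^ s <= 1 - u by apply: ge1r_powR => //; lra.
lra.
Qed.

Lemma powR_sum_ge1 s u w : 0 <= s <= 1 -> 0 < u -> 0 < w -> u + w = 1 ->
  1 <= u `^ s + w `^ s.
Proof.
move=> s1 u0 w0 uw.
have A : u <= u `^ s by apply: ger1_powR; lra.
have B : w <= w `^ s by apply: ger1_powR; lra.
lra.
Qed.

End Pnorm.

(** * Reduced pairs of lattice vectors *)

Section ReducedPair.
Context {R : realType}.
Implicit Types (p : \bar R) (alpha t k r : R) (a q : int).

Definition err alpha a q : R := a%:~R - alpha * q%:~R.

(** Abstracts two consecutive convergents [a0 / q0] and [a1 / q1]. The value [q0 = 0] admits the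
    formal convergent 1/0 as a start, and [q0 <= q1] is weak because the denominators may begin 1,
    1. *)
Record reduced_pair alpha a0 q0 a1 q1 : Prop := ReducedPair {
  reduced_q0 : 0 <= q0;
  reduced_q1 : 0 < q1;
  reduced_q01 : q0 <= q1;
  reduced_opp : err alpha a0 q0 * err alpha a1 q1 < 0;
  reduced_err : `|err alpha a1 q1| < `|err alpha a0 q0|;
  reduced_det : `|a0 * q1 - a1 * q0| = 1 }.

Lemma normr_opp_sub (x y u v : R) : x * y < 0 -> 0 <= u -> 0 <= v ->
  `|u * x - v * y| = u * `|x| + v * `|y|.
Proof.
move=> xy u0 v0.
have [x0|x0] := ltP x 0.
  have y0 : 0 < y by nra.
  rewrite (ltr0_norm x0) (gtr0_norm y0) ler0_norm; first by ring.
  by nra.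
have y0 : y < 0 by nra.
rewrite (ger0_norm x0) (ltr0_norm y0) ger0_norm; first by ring.
by nra.
Qed.

(** The determinant of the two lattice vectors is 1 up to sign; as the errors have opposite signs,
    its two terms add up in absolute value. *)
Lemma reduced_area alpha a0 q0 a1 q1 : reduced_pair alpha a0 q0 a1 q1 ->
  q1%:~R * `|err alpha a0 q0| + q0%:~R * `|err alpha a1 q1| = 1.
Proof.
move=> [q00 q10 _ opp _ det].
rewrite -normr_opp_sub ?ler0z ?(ltW q10)//.
rewrite -[RHS](_ : `|a0 * q1 - a1 * q0|%:~R = 1 :> R); last by rewrite det.
rewrite intr_norm intrB !intrM; congr (`| _ |); rewrite /err; ring.
Qed.

(** Cramer's rule; the determinant [e] is its own inverse. *)
Lemma reduced_span alpha a0 q0 a1 q1 : reduced_pair alpha a0 q0 a1 q1 ->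
  forall a q, exists m l, q = m * q0 + l * q1 /\ a = m * a0 + l * a1.
Proof.
move=> [_ _ _ _ _ det] a q; pose e := a0 * q1 - a1 * q0.
have e2 : e * e = 1 by rewrite -expr2 -real_normK ?num_real// det expr1n.
exists (e * (a * q1 - a1 * q)), (e * (a0 * q - a * q0)); split.
  by rewrite -[LHS]mul1r -e2 /e; ring.
by rewrite -[LHS]mul1r -e2 /e; ring.
Qed.

Lemma err_comb alpha a0 q0 a1 q1 m l :
  err alpha (m * a0 + l * a1) (m * q0 + l * q1) =
  m%:~R * err alpha a0 q0 + l%:~R * err alpha a1 q1.
Proof. by rewrite /err !intrD !intrM; ring. Qed.

Lemma intr_norm_ge1 (m : int) : m != 0 -> 1 <= `|m%:~R| :> R.
Proof. by move=> m0; rewrite -intr_norm -[leLHS]/(1%:~R) ler_int; lia. Qed.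

Lemma approx_normZ_ge p alpha t a q m : (1 <= p)%E -> m != 0 ->
  approx_norm p alpha t a q <= approx_norm p alpha t (m * a) (m * q).
Proof.
move=> p1 m0.
have m1 := intr_norm_ge1 m0.
apply: le_pnorm => //=; rewrite !intrM.
  by rewrite mulrCA [leRHS]normrM ler_peMl.
have -> : t * (m%:~R * a%:~R - alpha * (m%:~R * q%:~R)) =
    m%:~R * (t * (a%:~R - alpha * q%:~R)) by ring.
by rewrite [leRHS]normrM ler_peMl.
Qed.

(** Write the vector as [m * v0 + l * v1] with [m] and [l] nonzero. If the signs agree, then
    [q >= q0 + q1], and the area identity gives [t <= q0 + q1], so the first coordinate is at least
    1. If they differ, the errors reinforce each other to at least [E0 + E1], and
    [q1 * (E0 + E1) >= 1] by the same identity. *)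
Lemma reduced_other_ge1 p alpha t a0 q0 a1 q1 a q : (1 <= p)%E ->
  reduced_pair alpha a0 q0 a1 q1 ->
  q1%:~R <= t -> t * `|err alpha a0 q0| <= 1 -> 0 < q ->
  [\/ 1 <= approx_norm p alpha t a q,
      approx_norm p alpha t a0 q0 <= approx_norm p alpha t a q |
      approx_norm p alpha t a1 q1 <= approx_norm p alpha t a q].
Proof.
move=> p1 hr tq te q_gt0; have area := reduced_area hr.
have [m [l [qE aE]]] := reduced_span hr a q.
have [q00 q10 q01 opp lt_err _] := hr.
have Q0 : 0 <= q0%:~R :> R by rewrite ler0z.
have Q1 : 0 < q1%:~R :> R by rewrite ltr0z.
have t0 : 0 < t by lra.
have [m0|m0] := eqVneq m 0.
  apply: Or33; rewrite aE qE m0 !mul0r !add0r.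
  by apply: approx_normZ_ge => //; apply: contraTneq q_gt0 => l0; rewrite qE m0 l0; lia.
have [l0|l0] := eqVneq l 0.
  apply: Or32; rewrite aE qE l0 !mul0r !addr0.
  exact: approx_normZ_ge.
apply: Or31; set E0 : R := `|err _ a0 q0| in area lt_err te; set E1 : R := `|err _ a1 q1| in area lt_err.
have E1_ge0 : 0 <= E1 by rewrite normr_ge0.
have [ml|ml] := ltP 0 (m * l).
  have [mp|mn] : (1 <= m /\ 1 <= l) \/ (m <= -1 /\ l <= -1) by clear -ml m0 l0; nia.
    have qq : q0 + q1 <= q by clear -mp qE q00 q10; nia.
    apply: (le_trans _ (pnorm_ge_l _ p1)) => /=.
    have qq' : q0%:~R + q1%:~R <= q%:~R :> R by rewrite -intrD ler_int.
    rewrite ger0_norm; last by rewrite mulr_ge0 ?invr_ge0 ?ler0z ?(ltW t0) ?(ltW q_gt0).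
    rewrite mulrC ler_pdivlMr// mul1r.
    have h1 : t * (q1%:~R * E0 + q0%:~R * E1) <= q1%:~R + q0%:~R * 1.
      rewrite mulrDr; apply: lerD; first by rewrite mulrCA ger_pMr.
      by rewrite mulrCA ler_wpM2l//; nra.
    rewrite area in h1; lra.
  exfalso; clear -mn qE q00 q10 q_gt0; nia.
apply: (le_trans _ (pnorm_ge_r _ p1)) => /=.
rewrite -/(err alpha a q) normrM (gtr0_norm t0).
have : E0 + E1 <= `|err alpha a q|.
  rewrite aE qE err_comb.
  have opp' : m%:~R * l%:~R < 0 :> R.
    by rewrite -intrM ltrz0 lt_neqAle ml andbT mulf_neq0.
  have -> : m%:~R * err alpha a0 q0 + l%:~R * err alpha a1 q1 =
      err alpha a0 q0 * m%:~R - (- err alpha a1 q1) * l%:~R by ring.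
  have M1 := intr_norm_ge1 m0.
  have L1 := intr_norm_ge1 l0.
  have [e0|e0] := leP 0 (err alpha a0 q0).
    have e1 : err alpha a1 q1 < 0 by nra.
    rewrite normr_opp_sub//; last lra.
    by rewrite /E0 /E1 (ger0_norm e0) (ltr0_norm e1) lerD// ler_peMr//; lra.
  have e1 : 0 < err alpha a1 q1 by nra.
  rewrite -normrN; have -> : - (err alpha a0 q0 * m%:~R - - err alpha a1 q1 * l%:~R) =
    - err alpha a0 q0 * m%:~R - err alpha a1 q1 * l%:~R by ring.
  rewrite normr_opp_sub//; [|lra|lra].
  by rewrite /E0 /E1 (ltr0_norm e0) (gtr0_norm e1) lerD// ler_peMr//; lra.
have Q01 : q0%:~R <= q1%:~R :> R by rewrite ler_int.
move=> h; apply: (@le_trans _ _ (t * (E0 + E1))); last by rewrite ler_wpM2l// ltW.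
apply: (@le_trans _ _ (q1%:~R * (E0 + E1))); last by rewrite ler_wpM2r//; lra.
by rewrite -[leLHS]area mulrDr lerD2l ler_wpM2r.
Qed.

(** At [t = sqrt (q1 / E0)] the first coordinate of [v1] and the second of [v0] both have square
    [q1 * E0]. This [t] lies between [q1] and [1 / E0] because [q1 * E0 <= 1]. *)
Lemma reduced_balance_max alpha a0 q0 a1 q1 : reduced_pair alpha a0 q0 a1 q1 ->
  exists2 t, q1%:~R <= t & forall a q, 0 < q ->
    q1%:~R * `|err alpha a0 q0| <= approx_norm +oo%E alpha t a q ^+ 2.
Proof.
move=> hr; have area := reduced_area hr.
have [q00 q10 q01 opp lt_err _] := hr.
have Q0 : 0 <= q0%:~R :> R by rewrite ler0z.
have Q1 : 0 < q1%:~R :> R by rewrite ltr0z.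
have E1_ge0 := normr_ge0 (err alpha a1 q1).
set E0 : R := `|err _ a0 q0| in area lt_err *; set E1 : R := `|err _ a1 q1| in area lt_err E1_ge0.
have E0_gt0 : 0 < E0 by lra.
have u1 : q1%:~R * E0 <= 1 by nra.
have u0 : 0 <= q1%:~R * E0 by nra.
pose t := Num.sqrt (q1%:~R / E0).
have t_gt0 : 0 < t by rewrite sqrtr_gt0 divr_gt0.
have t2 : t ^+ 2 = q1%:~R / E0 by rewrite sqr_sqrtr// divr_ge0// ltW.
have t2E : t ^+ 2 * E0 = q1%:~R by rewrite t2 divfK// gt_eqF.
have tq : q1%:~R <= t.
  rewrite -(@ler_pXn2r _ 2) ?nnegrE ?(ltW t_gt0) ?(ltW Q1)// t2 ler_pdivlMr//.
  by rewrite expr2 -mulrA ger_pMr.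
have te : t * E0 <= 1.
  rewrite -(@ler_pXn2r _ 2) ?nnegrE ?expr1n ?mulr_ge0 ?(ltW t_gt0) ?(ltW E0_gt0)//.
  by rewrite exprMn [E0 ^+ 2]expr2 mulrA t2E.
exists t => // a q q_gt0.
have p1 : (1%:E <= +oo :> \bar R)%E by rewrite leey.
have sq x : 0 <= x -> q1%:~R * E0 <= x ^+ 2 -> forall y, x <= y -> q1%:~R * E0 <= y ^+ 2.
  by move=> x0 hx y xy; apply: (le_trans hx); rewrite ler_pXn2r ?nnegrE// (le_trans x0).
have [h|h|h] := reduced_other_ge1 a p1 hr tq te q_gt0; apply: (sq _ _ _ _ h) => //.
- by rewrite expr1n.
- exact: pnorm_ge0.
- apply: (sq (t * E0)); [by rewrite mulr_ge0 ?ltW|by rewrite exprMn [E0 ^+ 2]expr2 mulrA t2E|].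
  apply: (le_trans _ (pnorm_ge_r _ p1)) => /=.
  by rewrite normrM (gtr0_norm t_gt0).
- exact: pnorm_ge0.
- apply: (sq (t^-1 * q1%:~R)).
  + by rewrite mulr_ge0 ?invr_ge0 ?ltW.
  + by rewrite exprMn exprVn t2 invf_div expr2 mulrA divfK ?gt_eqF// mulrC.
  apply: (le_trans _ (pnorm_ge_l _ p1)) => /=.
  by rewrite normrM (gtr0_norm Q1) gtr0_norm ?invr_gt0.
Qed.

End ReducedPair.

(** * Balancing two consecutive convergents for finite exponents *)

Section Balance.
Context {R : realType}.
Implicit Types (alpha t k r : R) (a q : int).

(** Cauchy-Schwarz for the vectors of square roots of [(x0, y0)] and [(y1, x1)]; [f] and [h] stand
    for the two terms of their inner product. *)
Lemma cauchy_cross (x0 y0 x1 y1 f h : R) : 0 <= x0 -> 0 <= y0 -> 0 <= x1 -> 0 <= y1 ->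
  0 <= f -> 0 <= h -> f ^+ 2 = x0 * y1 -> h ^+ 2 = x1 * y0 ->
  (f + h) ^+ 2 <= (x0 + y0) * (x1 + y1).
Proof.
move=> x00 y00 x10 y10 f0 h0 f2 h2.
have : f * h *+ 2 <= x0 * x1 + y0 * y1.
  rewrite -(@ler_pXn2r _ 2) ?nnegrE ?addr_ge0 ?mulrn_wge0 ?mulr_ge0//.
  rewrite -mulr_natr !exprMn f2 h2.
  have := sqr_ge0 (x0 * x1 - y0 * y1); nra.
by rewrite sqrrD f2 h2; nra.
Qed.

Lemma approx_norm_finE r alpha t a q : 0 < t ->
  approx_norm r%:E alpha t a q =
  (`|q%:~R| `^ r / t `^ r + t `^ r * `|err alpha a q| `^ r) `^ r^-1.
Proof.
move=> t0; rewrite /approx_norm /rescale /= !normrM (gtr0_norm t0).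
have tV : 0 <= t^-1 by rewrite invr_ge0 ltW.
rewrite (ger0_norm tV) (powRM _ tV (normr_ge0 _)) (powRM _ (ltW t0) (normr_ge0 _)).
by rewrite -(powR_inv1 (ltW t0)) powRAC (powR_inv1 (powR_ge0 _ _)) [_^-1 * _]mulrC; reflexivity.
Qed.

(** Put [T = t ^ r]. The [r]-th powers of the two norms are [A0 / T + T * B0] and [A1 / T + T * B1],
    and the second exceeds the first exactly while [T ^ 2 < (A1 - A0) / (B0 - B1)]. The three cases
    are whether this crossing lies before, after or inside the admissible interval for [t]. *)
Lemma reduced_balance_fin r k alpha a0 q0 a1 q1 : 1 <= r ->
  reduced_pair alpha a0 q0 a1 q1 -> q0 < q1 -> 0 <= k <= 1 ->
  k <= ((q1%:~R * `|err alpha a0 q0|) `^ (r / 2)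
        + (q0%:~R * `|err alpha a1 q1|) `^ (r / 2)) `^ (2 / r) ->
  exists2 t, q1%:~R <= t & forall a q, 0 < q ->
    k <= approx_norm r%:E alpha t a q ^+ 2.
Proof.
move=> r1 hr q01 /andP[k0 k1] hk; have area := reduced_area hr.
have [q00 q10 _ opp lt_err _] := hr.
have p1 : (1%:E <= r%:E)%E by rewrite lee_fin.
have r0 : 0 < r by lra.
have Q0 : 0 <= q0%:~R :> R by rewrite ler0z.
have Q1 : 0 < q1%:~R :> R by rewrite ltr0z.
have E1_ge0 := normr_ge0 (err alpha a1 q1).
set E0 : R := `|err _ a0 q0| in area lt_err hk *.
set E1 : R := `|err _ a1 q1| in area lt_err hk E1_ge0.
have E0_gt0 : 0 < E0 by lra.
pose A0 : R := q0%:~R `^ r; pose A1 : R := q1%:~R `^ r.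
pose B0 : R := E0 `^ r; pose B1 : R := E1 `^ r.
have A01 : A0 < A1 by apply: gt0_ltr_powR; rewrite ?nnegrE ?ltr_int// ltW.
have B01 : B1 < B0 by apply: gt0_ltr_powR; rewrite ?nnegrE// ltW.
have [A0_ge0 B1_ge0] : 0 <= A0 /\ 0 <= B1 by split; apply: powR_ge0.
have N0E t : 0 < t -> approx_norm r%:E alpha t a0 q0 =
    (A0 / t `^ r + t `^ r * B0) `^ r^-1.
  by move=> t0; rewrite (approx_norm_finE _ _ _ _ t0) (ger0_norm Q0); reflexivity.
have N1E t : 0 < t -> approx_norm r%:E alpha t a1 q1 =
    (A1 / t `^ r + t `^ r * B1) `^ r^-1.
  by move=> t0; rewrite (approx_norm_finE _ _ _ _ t0) (gtr0_norm Q1); reflexivity.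
have concl t : q1%:~R <= t -> t * E0 <= 1 ->
    k <= approx_norm r%:E alpha t a0 q0 ^+ 2 ->
    k <= approx_norm r%:E alpha t a1 q1 ^+ 2 ->
    exists2 t, q1%:~R <= t & forall a q, 0 < q ->
      k <= approx_norm r%:E alpha t a q ^+ 2.
  move=> tq te h0 h1; exists t; first exact: tq.
  move=> a q q_gt0.
  have sq (x y : R) : 0 <= x -> x <= y -> x ^+ 2 <= y ^+ 2.
    by move=> x0 xy; rewrite ler_pXn2r ?nnegrE// (le_trans x0).
  have [h|h|h] := reduced_other_ge1 a p1 hr tq te q_gt0.
  - apply: (le_trans k1); rewrite -[leLHS](expr1n _ 2); exact: (sq _ _ ler01 h).
  - apply: (le_trans h0); exact: (sq _ _ (pnorm_ge0 _ _) h).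
  - apply: (le_trans h1); exact: (sq _ _ (pnorm_ge0 _ _) h).
have sq1 (x y : R) : 1 <= x -> x <= y -> k <= y ^+ 2.
  by move=> x1 xy; apply: (le_trans k1); nra.
have ex (T : R) : 0 < T -> A1 / T + T * B1 - (A0 / T + T * B0) =
    (A1 - A0 - T ^+ 2 * (B0 - B1)) / T.
  by move=> T0; field; rewrite gt_eqF.
have tT (t : R) : 0 < t -> 0 < t `^ r by move=> t0; exact: powR_gt0.
have mono (x y : R) : 0 <= x -> x <= y -> x `^ r^-1 <= y `^ r^-1.
  by move=> x0 xy; apply: ler_powR2; rewrite ?invr_ge0 ?(ltW r0).
have u1 : q1%:~R * E0 <= 1 by rewrite -[leRHS]area lerDl mulr_ge0.
have S_ge0 (A B T : R) : 0 < T -> 0 <= A -> 0 <= B -> 0 <= A / T + T * B.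
  by move=> T0 A_ge0 B_ge0; rewrite addr_ge0 ?mulr_ge0 ?invr_ge0 ?(ltW T0).
(* Crossing at or before [t = q1]: there [v1] has norm at least 1 from its first coordinate, and
   [v0] is at least as long. *)
have [D1|D1] := leP (A1 - A0) ((q1%:~R `^ r) ^+ 2 * (B0 - B1)).
  have N1 : 1 <= approx_norm r%:E alpha q1%:~R a1 q1.
    apply: (le_trans _ (pnorm_ge_l _ p1)) => /=.
    by rewrite mulVf ?normr1// gt_eqF.
  apply: (concl q1%:~R); [exact: lexx|exact: u1| |exact: (sq1 _ _ N1 (lexx _))].
  apply: (sq1 _ _ N1); rewrite (N1E _ Q1) (N0E _ Q1); apply: mono.
    by apply: S_ge0; rewrite ?tT//; lra.
  rewrite -subr_le0 ex ?tT// pmulr_lle0 ?invr_gt0 ?tT//; lra.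
(* Crossing at or after [t = 1 / E0]: there [v0] has norm at least 1 from its second coordinate, and
   [v1] is at least as long. *)
have [D2|D2] := leP ((E0^-1 `^ r) ^+ 2 * (B0 - B1)) (A1 - A0).
  have t0 : 0 < E0^-1 by rewrite invr_gt0.
  have N0 : 1 <= approx_norm r%:E alpha E0^-1 a0 q0.
    apply: (le_trans _ (pnorm_ge_r _ p1)) => /=.
    by rewrite normrM (gtr0_norm t0) mulVf// gt_eqF.
  apply: (concl E0^-1).
  - by rewrite -[leRHS]mul1r ler_pdivlMr.
  - by rewrite mulVf// gt_eqF.
  - exact: (sq1 _ _ N0 (lexx _)).
  apply: (sq1 _ _ N0); rewrite (N1E _ t0) (N0E _ t0); apply: mono.
    by apply: S_ge0; rewrite ?tT//; lra.
  rewrite -subr_ge0 ex ?tT// pmulr_lge0 ?invr_gt0 ?tT//; lra.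
pose T := Num.sqrt ((A1 - A0) / (B0 - B1)); pose t := T `^ r^-1.
have T_gt0 : 0 < T by rewrite sqrtr_gt0 divr_gt0// subr_gt0.
have t_gt0 : 0 < t by apply: powR_gt0.
have T2 : T ^+ 2 = (A1 - A0) / (B0 - B1) by rewrite sqr_sqrtr// divr_ge0// subr_ge0 ltW.
have tTE : t `^ r = T by rewrite /t powRVK ?gt_eqF// ltW.
have T2B : T ^+ 2 * (B0 - B1) = A1 - A0 by rewrite T2 divfK// gt_eqF// subr_gt0.
have lt_pow (x y : R) : 0 < x -> 0 < y -> (x `^ r) ^+ 2 * (B0 - B1) < (y `^ r) ^+ 2 * (B0 - B1) -> x <= y.
  move=> x0 y0; rewrite ltr_pM2r ?subr_gt0// => xy.
  rewrite leNgt; apply/negP => yx; move: xy; rewrite ltNge => /negP; apply.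
  rewrite ler_pXn2r ?nnegrE ?powR_ge0//.
  by apply: ler_powR2; apply: ltW.
have eqS : A1 / T + T * B1 = A0 / T + T * B0.
  by apply/eqP; rewrite -subr_eq0 ex// T2B subrr mul0r.
have bal : k <= ((A0 / T + T * B0) `^ r^-1) ^+ 2.
  apply: (le_trans hk).
  set f := (_ * E1) `^ _; set h := (_ * E0) `^ _.
  have f2 : f ^+ 2 = A0 / T * (T * B1).
    rewrite mulrA divfK ?gt_eqF// -powRM// -powR_mulrn ?powR_ge0// -powRrM.
    by rewrite divfK.
  have h2 : h ^+ 2 = A1 / T * (T * B0).
    rewrite mulrA divfK ?gt_eqF// -powRM// ?ltW// -powR_mulrn ?powR_ge0// -powRrM.
    by rewrite divfK.
  (* At the crossing both sums agree, so the product in [cauchy_cross] is the square of their common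
     value. *)
  have fh : h + f <= A0 / T + T * B0.
    rewrite -(@ler_pXn2r _ 2) ?nnegrE ?addr_ge0 ?powR_ge0//; last first.
    - by rewrite mulr_ge0 ?powR_ge0 ?ltW.
    - by rewrite divr_ge0// ltW.
    rewrite [leRHS]expr2 -{2}eqS addrC; apply: cauchy_cross => //;
      by rewrite ?mulr_ge0 ?invr_ge0 ?powR_ge0// ltW.
  rewrite -powR_mulrn ?powR_ge0// -powRrM [r^-1 * _]mulrC.
  by apply: ler_powR2 => //; rewrite ?divr_ge0 ?addr_ge0 ?powR_ge0// ltW.
apply: (concl t).
- by apply: lt_pow; rewrite // tTE T2B.
- rewrite -ler_pdivlMr// mul1r; apply: lt_pow; rewrite ?invr_gt0//.
  by rewrite tTE T2B.
- by rewrite (N0E _ t_gt0) tTE; exact: bal.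
- by rewrite (N1E _ t_gt0) tTE eqS; exact: bal.
Qed.

End Balance.

(** * Continued fractions *)

Section Convergents.
Context {R : realType}.
Implicit Types (p : \bar R) (alpha t k r : R) (a q : int).

Lemma err_neq0 alpha a q : irrational alpha -> 0 < q -> err alpha a q != 0.
Proof.
move=> irr q0; apply/eqP => e0; apply: irr; apply/rationalP; exists a, `|q|%N.
have qR : 0 < q%:~R :> R by rewrite ltr0z.
rewrite natr_absz gtr0_norm//; apply: (mulIf (lt0r_neq0 qR)).
by rewrite divfK ?lt0r_neq0//; move: e0; rewrite /err => /subr0_eq ->.
Qed.

Lemma reduced_start alpha : irrational alpha ->
  reduced_pair alpha 1 0 (Num.floor alpha) 1.
Proof.
move=> irr; have e1 := err_neq0 (Num.floor alpha) irr ltr01.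
have lt1 := floorD1_gt alpha; have ge0 := floor_le alpha.
have E0 : err alpha 1 0 = 1 by rewrite /err mulr0 subr0.
have E1 : err alpha (Num.floor alpha) 1 < 0.
  by rewrite lt_neqAle e1 /err mulr1 subr_le0.
split=> //; rewrite ?E0 ?mul1r//.
- rewrite normr1 ltr0_norm// /err mulr1 opprB; move: lt1; rewrite intrD; lra.
- by rewrite !(mulr0, subr0, mulr1, normr1).
Qed.

(** One step of the Euclidean algorithm on the errors: [k] is the partial quotient
    [floor (E0 / E1)], and the new error is the remainder, nonzero by irrationality. The last
    conjunct keeps the division identity for [three_consecutive]. *)
Lemma reduced_step alpha a0 q0 a1 q1 : irrational alpha ->
  reduced_pair alpha a0 q0 a1 q1 -> exists k : int, [/\ 1 <= k,
    reduced_pair alpha a1 q1 (k * a1 + a0) (k * q1 + q0) &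
    `|err alpha a0 q0| =
      k%:~R * `|err alpha a1 q1| + `|err alpha (k * a1 + a0) (k * q1 + q0)| ].
Proof.
move=> irr [q00 q10 q01 opp lt_err det].
set E0 : R := `|err alpha a0 q0| in lt_err *; set E1 : R := `|err alpha a1 q1| in lt_err *.
have E1_gt0 : 0 < E1 by rewrite normr_gt0 err_neq0.
pose k := Num.floor (E0 / E1).
have k_le : k%:~R * E1 <= E0 by rewrite -ler_pdivlMr// floor_le.
have k_gt : E0 < (k%:~R + 1) * E1.
  by rewrite -ltr_pdivrMr// -[1]/(1%:~R) -intrD floorD1_gt.
have k1 : 1 <= k by rewrite floor_ge_int ler_pdivlMr// mul1r ltW.
have q20 : 0 < k * q1 + q0 by clear -k1 q10 q00; nia.
have e2 := err_neq0 (k * a1 + a0) irr q20.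
have e2E : err alpha (k * a1 + a0) (k * q1 + q0) = k%:~R * err alpha a1 q1 + err alpha a0 q0.
  by have := err_comb alpha a1 q1 a0 q0 k 1; rewrite !mul1r.
have [E2E sgn] : `|err alpha (k * a1 + a0) (k * q1 + q0)| = E0 - k%:~R * E1 /\
    err alpha a1 q1 * err alpha (k * a1 + a0) (k * q1 + q0) < 0.
  have ne : E0 - k%:~R * E1 != 0.
    move: e2; rewrite -normr_eq0 e2E /E0 /E1; apply: contra => /eqP.
    have [h|h] := ltP (err alpha a0 q0) 0.
      have h' : 0 < err alpha a1 q1 by nra.
      by rewrite (ltr0_norm h) (gtr0_norm h') => hh; rewrite normr_eq0; apply/eqP; lra.
    have h' : err alpha a1 q1 < 0 by nra.
    by rewrite (ger0_norm h) (ltr0_norm h') => hh; rewrite normr_eq0; apply/eqP; lra.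
  have pos : 0 < E0 - k%:~R * E1 by rewrite lt_neqAle eq_sym ne subr_ge0.
  move: pos; rewrite e2E /E0 /E1.
  have [h|h] := ltP (err alpha a0 q0) 0.
    have h' : 0 < err alpha a1 q1 by nra.
    rewrite (ltr0_norm h) (gtr0_norm h') => hh; split; last by rewrite pmulr_rlt0//; lra.
    by rewrite ltr0_norm; lra.
  have h' : err alpha a1 q1 < 0 by nra.
  rewrite (ger0_norm h) (ltr0_norm h') => hh; split; last by rewrite nmulr_rlt0//; lra.
  by rewrite gtr0_norm; lra.
exists k; split => //; last by rewrite E2E; lra.
split=> //; first exact: ltW.
- by clear -k1 q10 q00; nia.
- by rewrite E2E -/E1; lra.
- rewrite -det -normrN; congr (`| _ |); ring.
Qed.

Lemma reduced_unbounded alpha (n : nat) : irrational alpha ->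
  exists a0 q0 a1 q1, [/\ reduced_pair alpha a0 q0 a1 q1,
    0 < q0, q0 < q1 & n%:Z <= q1].
Proof.
move=> irr; elim: n => [|n [a0 [q0 [a1 [q1 [hr q00 q01 nq]]]]]].
  (* The denominators start 0, 1, k, and [k] may be 1; after two steps they are positive and
     strictly increasing. *)
  have [k [k1 hr _]] := reduced_step irr (reduced_start irr).
  have [l [l1 hr' _]] := reduced_step irr hr.
  by do 4 eexists; split; first exact: hr'; nia.
have [k [k1 hr' _]] := reduced_step irr hr.
by do 4 eexists; split; first exact: hr'; nia.
Qed.

(** Take consecutive denominators with [q0 <= t < q1]; then [t * E0 <= q1 * E0 <= 1] by the area
    identity. Without such a pair all denominators would stay below [t]. *)
Lemma dirichlet alpha t : irrational alpha -> 1 <= t ->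
  exists a q, [/\ 0 < q, q%:~R <= t & t * `|err alpha a q| <= 1].
Proof.
move=> irr t1.
suff [a0 [q0 [a1 [q1 [hr q00 q0t tq1]]]]] : exists a0 q0 a1 q1,
    [/\ reduced_pair alpha a0 q0 a1 q1, 0 < q0, q0%:~R <= t & t < q1%:~R].
  exists a0, q0; split => //; rewrite -[leRHS](reduced_area hr).
  have : 0 <= q0%:~R * `|err alpha a1 q1| by rewrite mulr_ge0// ler0z ltW.
  have : t * `|err alpha a0 q0| <= q1%:~R * `|err alpha a0 q0|.
    by rewrite ler_wpM2r// ltW.
  lra.
apply: contrapT => hn.
have H (n : nat) : exists a0 q0 a1 q1, [/\ reduced_pair alpha a0 q0 a1 q1,
    0 < q1, n%:Z <= q1 & q1%:~R <= t].
  elim: n => [|n [a0 [q0 [a1 [q1 [hr q10 nq q1t]]]]]].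
    by exists 1, 0, (Num.floor alpha), 1; split => //; exact: reduced_start.
  have [k [k1 hr' _]] := reduced_step irr hr.
  have [q2t|q2t] := ltP t (k * q1 + q0)%:~R.
    by exfalso; apply: hn; exists a1, q1, (k * a1 + a0), (k * q1 + q0).
  (* From [q0 = 0] a single step with partial quotient 1 does not raise the denominator, so two
     steps are taken. *)
  have [q0_0|q0_0] := eqVneq q0 0.
    have [l [l1 hr'' _]] := reduced_step irr hr'.
    have [q3t|q3t] := ltP t (l * (k * q1 + q0) + q1)%:~R.
      exfalso; apply: hn; do 4 eexists; split; [exact: hr''| |exact: q2t|exact: q3t].
      by rewrite q0_0; nia.
    do 4 eexists; split; [exact: hr''| | |exact: q3t]; rewrite q0_0; nia.
  have q00 := reduced_q0 hr.
  do 4 eexists; split; [exact: hr'| | |exact: q2t]; nia.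
have [a0 [q0 [a1 [q1 [_ _ nq q1t]]]]] := H (Num.trunc t).+1.
have := truncnS_gt t; rewrite ltNge => /negP; apply.
by apply: le_trans q1t; rewrite pmulrn ler_int.
Qed.

(** A crude bound that ensures the existence of the threshold: Dirichlet's vector lies in the unit
    square, where every p-norm is at most 2. *)
Lemma eventually_below4 p alpha : (1 <= p)%E -> irrational alpha ->
  eventually_below p alpha 4.
Proof.
move=> p1 irr e e0; exists 1; split; first by rewrite num_real.
move=> t t1; have t0 : 0 < t by lra.
have [a [q [q0 qt te]]] := dirichlet irr (ltW t1).
exists a, q; split => //.
have qR : 0 < q%:~R :> R by rewrite ltr0z.
have h1 : `|t^-1 * q%:~R| <= 1.
  by rewrite normrM (gtr0_norm qR) gtr0_norm ?invr_gt0// mulrC ler_pdivrMr// mul1r.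
have h2 : `|t * err alpha a q| <= 1 by rewrite normrM (gtr0_norm t0).
have h3 : `|t^-1 * q%:~R| * `|t * err alpha a q| <= 1 by apply: mulr_ile1.
have N2 : approx_norm p alpha t a q <= 1 + 1 := pnorm_le_thin p1 h1 h2 h3 (lexx _).
have N0 : 0 <= approx_norm p alpha t a q := pnorm_ge0 _ _.
move: N2 N0; set N := approx_norm _ _ _ _ _; nra.
Qed.

(* Dirichlet analogue of Hurwitz's theorem: with [b = q0 / q1] and [c = E3 / E2]
   the three failures contradict [4 b c <= (b + c)^2] when [k = l = 1]. *)
Lemma three_consecutive (q0 q1 q2 q3 E0 E1 E2 E3 : R) (k l : int) :
  0 <= q0 -> 0 < q1 -> 0 < E2 -> 0 <= E3 -> 1 <= k -> 1 <= l ->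
  q2 = k%:~R * q1 + q0 -> q3 = l%:~R * q2 + q1 ->
  E0 = k%:~R * E1 + E2 -> E1 = l%:~R * E2 + E3 ->
  q1 * E0 + q0 * E1 = 1 -> q2 * E1 + q1 * E2 = 1 -> q3 * E2 + q2 * E3 = 1 ->
  let u := (Num.sqrt 5 + 5) / 10 in
  [\/ u <= q1 * E0, u <= q2 * E1 | u <= q3 * E2].
Proof.
have s2 : Num.sqrt 5 ^+ 2 = 5 :> R by rewrite sqr_sqrtr.
have s0 : 0 <= Num.sqrt 5 :> R by rewrite sqrtr_ge0.
set s : R := Num.sqrt 5 in s2 s0 *.
have s1 : 2 < s by nra.
have s1' : s < 9 / 4 by nra.
(* [G] is the square of the golden ratio and the bound [u] equals [1 / (1 + G)]. Hence, for
   [x + y = 1], failure of [u <= x] means [G * x < y]. *)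
pose G := (3 - s) / 2.
have GE (x y : R) : x + y = 1 -> x < (s + 5) / 10 -> G * x < y.
  by move=> xy hx; rewrite /G; nra.
have GG : G ^+ 2 = 3 * G - 1 by rewrite /G; nra.
have G0 : 3 / 8 < G by rewrite /G; lra.
have G1 : G < 1 / 2 by rewrite /G; lra.
have G_ge0 : 0 <= G by lra.
(* The contradiction rests on [2 * G + 2 * G ^ 2 >= 1]. It excludes a partial quotient of at least
   2: for [k] through the errors, for [l] through the denominators. *)
have gap (x y z : R) : 0 < x -> x + y <= z -> 2 * G * z < x -> G * x < y -> False.
  move=> x0 xyz zx xy.
  have h1 : 2 * G * (x + y) <= 2 * G * z by apply: ler_wpM2l => //; apply: mulr_ge0.
  have h2 : 2 * G * (G * x) <= 2 * G * y by apply: ler_wpM2l; [apply: mulr_ge0|apply: ltW].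
  have h3 : x * 1 <= x * (2 * G + 2 * G * G) by rewrite ler_wpM2l ?(ltW x0)//; nra.
  lra.
move=> q00 q10 E20 E30 k1 l1 q2E q3E E0E E1E ar0 ar1 ar2 u.
have [b0|b0] := leP u (q1 * E0); first exact: Or31.
have [b1|b1] := leP u (q2 * E1); first exact: Or32.
have [b2|b2] := leP u (q3 * E2); first exact: Or33.
exfalso.
have c0 := GE _ _ ar0 b0; have c1 := GE _ _ ar1 b1; have c2 := GE _ _ ar2 b2.
clear GE b0 b1 b2 ar0 ar1 ar2 u s2 s0 s1 s1'.
have kR : 1 <= k%:~R :> R by rewrite -[leLHS]/(1%:~R) ler_int.
have lR : 1 <= l%:~R :> R by rewrite -[leLHS]/(1%:~R) ler_int.
have q2_ge : q1 + q0 <= q2 by rewrite q2E lerD2r ler_peMl// ltW.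
have E1_ge : E2 + E3 <= E1 by rewrite E1E lerD2r ler_peMl// ltW.
have q2_gt0 : 0 < q2 by apply: lt_le_trans q2_ge; rewrite ltr_wpDr.
have E1_gt0 : 0 < E1 by apply: lt_le_trans E1_ge; rewrite ltr_wpDr.
have q3_ge : q2 <= q3.
  by rewrite q3E ler_wpDr// ?ler_peMl// ltW.
have E0_ge : E1 <= E0.
  by rewrite E0E ler_wpDr// ?ler_peMl// ltW.
have [k2|k2] := leP 2 k.
  have kR2 : 2 <= k%:~R :> R by rewrite -[leLHS]/(2%:~R) ler_int.
  have q2_ge2 : 2 * q1 <= q2 by rewrite q2E ler_wpDr// ler_wpM2r// ltW.
  have h1 : 2 * G * E1 < E2.
    rewrite -(ltr_pM2l q10); apply: le_lt_trans c1.
    rewrite (_ : q1 * _ = G * E1 * (2 * q1)); last by ring.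
    rewrite [leRHS](_ : _ = G * E1 * q2); last by ring.
    by rewrite ler_wpM2l// mulr_ge0// ltW.
  have h2 : G * E2 < E3.
    rewrite -(ltr_pM2l q2_gt0); apply: le_lt_trans c2.
    by rewrite mulrCA ler_wpM2l ?ler_wpM2r// ltW.
  exact: gap E20 E1_ge h1 h2.
have [l2|l2] := leP 2 l.
  have lR2 : 2 <= l%:~R :> R by rewrite -[leLHS]/(2%:~R) ler_int.
  have E1_ge2 : 2 * E2 <= E1 by rewrite E1E ler_wpDr// ler_wpM2r// ltW.
  have h1 : 2 * G * q2 < q1.
    rewrite -(ltr_pM2r E20); apply: le_lt_trans c1.
    rewrite (_ : _ * E2 = G * (q2 * (2 * E2))); last by ring.
    by rewrite ler_wpM2l ?ler_wpM2l// ltW.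
  have h2 : G * q1 < q0.
    rewrite -(ltr_pM2r E1_gt0); apply: le_lt_trans c0.
    by rewrite -mulrA ler_wpM2l ?ler_wpM2l// ltW.
  exact: gap q10 q2_ge h1 h2.
have kE : k = 1 by clear -k1 k2; lia.
have lE : l = 1 by clear -l1 l2; lia.
rewrite kE mul1r in q2E E0E; rewrite lE mul1r in q3E E1E.
have P0 : 0 < q1 * E2 by rewrite mulr_gt0.
pose b := q0 / q1; pose c := E3 / E2.
have bE : q0 = b * q1 by rewrite divfK ?gt_eqF.
have cE : E3 = c * E2 by rewrite divfK ?gt_eqF.
have red (x y : R) : x * (q1 * E2) < y * (q1 * E2) -> x < y by rewrite ltr_pM2r.
have d0 : G * (2 + c) < b * (1 + c).
  apply: red; move: c0; rewrite E0E E1E bE cE; congr (is_true (_ < _)); ring.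
have d1 : G * ((1 + b) * (1 + c)) < 1.
  apply: red; move: c1; rewrite q2E E1E bE cE; congr (is_true (_ < _)); ring.
have d2 : G * (2 + b) < (1 + b) * c.
  apply: red; move: c2; rewrite q3E q2E bE cE; congr (is_true (_ < _)); ring.
have bc0 : 0 <= b + c by rewrite addr_ge0 ?divr_ge0// ltW.
clear -d0 d1 d2 GG G0 G1 bc0.
have h1 : 1 + (b + c) + b * c < 3 - G.
  rewrite (_ : 1 + (b + c) + b * c = G * ((1 + b) * (1 + c)) * (3 - G)).
    by rewrite gtr_pMl//; lra.
  rewrite (_ : G * _ * _ = (3 * G - G ^+ 2) * ((1 + b) * (1 + c))); last by ring.
  by rewrite GG; ring.
have h2 : (b + c) * (1 + G) < (2 - 2 * G) * (1 + G).
  rewrite (_ : (2 - 2 * G) * _ = 2 - 2 * G ^+ 2); last by ring.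
  by rewrite GG; lra.
rewrite ltr_pM2r in h2; last lra.
(* Here [(1 - G) ^ 2 = G]. From [b + c < 2 * (1 - G)] follows [2 * b * c <= 2 * G], whereas the sum
   of [d0] and [d2] forces [2 * b * c > 4 * G - (1 - G) * (b + c) >= 2 * G]. *)
have h3 : 4 * (b * c) <= (b + c) ^+ 2 by have := sqr_ge0 (b - c); lra.
have h4 : (b + c) ^+ 2 <= (2 - 2 * G) ^+ 2.
  by rewrite ler_pXn2r ?nnegrE// ?ltW//; lra.
have h5 : (1 - G) * (b + c) <= (1 - G) * (2 - 2 * G) by rewrite ler_wpM2l// ?ltW//; lra.
lra.
Qed.

End Convergents.

(** * Lower bound *)

Section LowerBound.
Context {R : realType}.
Implicit Types (p : \bar R) (alpha t r : R) (a q : int).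

Let u0 : R := (Num.sqrt 5 + 5) / 10.

Lemma sqrt5_bounds :
  (Num.sqrt 5 ^+ 2 = 5 :> R) /\ (2 < Num.sqrt 5 :> R) && (Num.sqrt 5 < 9 / 4 :> R).
Proof.
have s2 : Num.sqrt 5 ^+ 2 = 5 :> R by rewrite sqr_sqrtr.
by split => //; have := sqrtr_ge0 (5 : R); nra.
Qed.

(** With [g] the golden ratio, [1 - u0 = u0 * g ^ 2], so [u0 ^ (r / 2)] factors out of the sum. *)
Lemma golden_factor_finE r : 0 < r ->
  u0 * golden_factor r%:E = (u0 `^ (r / 2) + (1 - u0) `^ (r / 2)) `^ (2 / r).
Proof.
move=> r0; have [s2 /andP[s_gt s_lt]] := sqrt5_bounds.
have u_ge0 : 0 <= u0 by rewrite /u0; lra.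
have g_ge0 : 0 <= 2^-1 * (Num.sqrt 5 - 1) :> R by lra.
have r2 : r / 2 * (2 / r) = 1 by field; rewrite gt_eqF.
rewrite {1}(_ : u0 = (u0 `^ (r / 2)) `^ (2 / r)); last by rewrite -powRrM r2 powRr1.
rewrite /=.
rewrite -powRM ?powR_ge0 ?addr_ge0 ?powR_ge0//.
congr (_ `^ _); rewrite mulrDr mulr1 addrC; congr (_ + _).
set g : R := 2^-1 * _ in g_ge0 *.
have -> : g `^ r = (g ^+ 2) `^ (r / 2).
  by rewrite -powR_mulrn// -powRrM [2 * _]mulrC divfK.
rewrite -powRM ?sqr_ge0//; congr (_ `^ _).
rewrite /u0 /g; nra.
Qed.

Lemma reduced_pair_above alpha (T : R) : irrational alpha ->
  exists a0 q0 a1 q1, [/\ reduced_pair alpha a0 q0 a1 q1, 0 < q0, q0 < q1 & T < q1%:~R].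
Proof.
move=> irr.
have [a0 [q0 [a1 [q1 [hr q00 q01 nq]]]]] := reduced_unbounded (Num.trunc T).+1 irr.
exists a0, q0, a1, q1; split => //; apply: (lt_le_trans (truncnS_gt T)).
by rewrite pmulrn ler_int.
Qed.

Lemma frequently_above_le2 p alpha : (1 <= p)%E -> (p <= 2%:E)%E ->
  irrational alpha -> frequently_above p alpha 1.
Proof.
case: p => [r| |]; [|by []|by []]; rewrite !lee_fin => r1 r2 irr T.
have [a0 [q0 [a1 [q1 [hr q00 q01 Tq]]]]] := reduced_pair_above T irr.
have r0 : 0 < r by lra.
have area := reduced_area hr.
have Q0 : 0 < q0%:~R :> R by rewrite ltr0z.
have Q1 : 0 < q1%:~R :> R by rewrite ltr0z (lt_trans q00).
have E1 : 0 < `|err alpha a1 q1| by rewrite normr_gt0 err_neq0// (lt_trans q00).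
have E0 : 0 < `|err alpha a0 q0| by rewrite normr_gt0 err_neq0.
have [||t tq ht] := @reduced_balance_fin R r 1 _ _ _ _ _ r1 hr q01.
- by rewrite ler01 lexx.
- set X := (X in X `^ (2 / r)).
  have X1 : 1 <= X.
    by apply: powR_sum_ge1; rewrite ?mulr_gt0//; apply/andP; split; lra.
  rewrite [leLHS](_ : 1 = 1 `^ (2 / r)); last by rewrite powR1.
  by apply: ler_powR2 => //; rewrite divr_ge0// ltW.
by exists t; first exact: lt_le_trans tq.
Qed.

Lemma reduced_golden_ge p alpha a0 q0 a1 q1 : (2%:E < p)%E ->
  reduced_pair alpha a0 q0 a1 q1 -> q0 < q1 ->
  u0 <= q1%:~R * `|err alpha a0 q0| ->
  exists2 t, q1%:~R <= t & forall a q, 0 < q ->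
    u0 * golden_factor p <= approx_norm p alpha t a q ^+ 2.
Proof.
case: p => [r| |]; [| |by []]; last first.
  move=> _ hr _ hu; have [t tq ht] := reduced_balance_max hr.
  by exists t => // a q q_gt0; rewrite mulr1; apply: (le_trans hu); apply: ht.
rewrite lte_fin => r2 hr q01 hu.
have r0 : 0 < r by lra.
have r1 : 1 <= r by lra.
have s1 : 1 <= r / 2 by lra.
have area := reduced_area hr.
have [s2 /andP[s_gt s_lt]] := sqrt5_bounds.
have u0_bd : 2^-1 <= u0 /\ u0 < 1 by rewrite /u0; split; lra.
rewrite (golden_factor_finE r0).
set w := q0%:~R * _ in area.
have w_ge0 : 0 <= w by rewrite mulr_ge0// ler0z (reduced_q0 hr).
set u := q1%:~R * _ in area hu.
apply: (@reduced_balance_fin R r _ _ _ _ _ _ r1 hr q01).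
  rewrite powR_ge0/= [leRHS](_ : 1 = 1 `^ (2 / r)); last by rewrite powR1.
  apply: ler_powR2; rewrite ?divr_ge0 ?addr_ge0 ?powR_ge0 ?(ltW r0)//.
  by apply: powR_sum_le1 => //; lra.
apply: ler_powR2; rewrite ?divr_ge0 ?addr_ge0 ?powR_ge0 ?(ltW r0)//.
rewrite -/u -/w (_ : w = 1 - u); last lra.
(* As [1/2 <= u0 <= u], the pair [(u, 1 - u)] is the more spread out one. *)
by apply: powR_sum_spread => //; lra.
Qed.

Lemma frequently_above_gt2 p alpha : (2%:E < p)%E -> irrational alpha ->
  frequently_above p alpha (u0 * golden_factor p).
Proof.
move=> p2 irr T.
have [a0 [q0 [a1 [q1 [hr q00 q01 Tq]]]]] := reduced_pair_above T irr.
have [k [k1 hr1 ek]] := reduced_step irr hr.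
have [l [l1 hr2 el]] := reduced_step irr hr1.
move: hr1 hr2 ek el; set a2 := k * a1 + a0; set q2 := k * q1 + q0.
set a3 := l * a2 + a1; set q3 := l * q2 + q1 => hr1 hr2 ek el.
have q12 : q1 < q2 by rewrite /q2; clear -k1 q00 q01; nia.
have q23 : q2 < q3 by rewrite /q3; clear -l1 q00 q01 q12; nia.
have le_int (x y : int) : x < y -> x%:~R <= y%:~R :> R by rewrite ler_int => /ltW.
have H (x : R) : q1%:~R <= x ->
    (exists2 t, x <= t & forall a q, 0 < q ->
      u0 * golden_factor p <= approx_norm p alpha t a q ^+ 2) ->
    exists2 t, T < t & forall a q, 0 < q ->
      u0 * golden_factor p <= approx_norm p alpha t a q ^+ 2.
  move=> q1x [t xt ht]; exists t; last exact: ht.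
  by apply: (lt_le_trans Tq); apply: le_trans xt.
have [] := @three_consecutive R q0%:~R q1%:~R q2%:~R q3%:~R
  `|err alpha a0 q0| `|err alpha a1 q1| `|err alpha a2 q2| `|err alpha a3 q3| k l.
- by rewrite ler0z ltW.
- by rewrite ltr0z (lt_trans q00).
- by rewrite normr_gt0 err_neq0// (lt_trans _ q12)// (lt_trans q00).
- exact: normr_ge0.
- exact: k1.
- exact: l1.
- by rewrite /q2 intrD intrM.
- by rewrite /q3 intrD intrM.
- exact: ek.
- exact: el.
- exact: reduced_area hr.
- exact: reduced_area hr1.
- exact: reduced_area hr2.
- by move=> h; apply: (H q1%:~R); [exact: lexx|exact: reduced_golden_ge hr q01 h].
- by move=> h; apply: (H q2%:~R); [exact: le_int|exact: reduced_golden_ge hr1 q12 h].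
- move=> h; apply: (H q3%:~R); [|exact: reduced_golden_ge hr2 q23 h].
  by apply: le_int; apply: lt_trans q23.
Qed.

End LowerBound.

(** * Upper bound *)

Section UpperBound.
Context {R : realType}.
Implicit Types (p : \bar R) (alpha t r e : R).

Lemma bracket (f : nat -> R) (N m : nat) t : f N <= t -> t < f (N + m)%N ->
  exists2 n, (N <= n)%N & f n <= t < f n.+1.
Proof.
move=> fN; elim: m => [|m IH] tf; first by move: tf; rewrite addn0 ltNge fN.
have [/IH//|ft] := ltP t (f (N + m)%N).
by exists (N + m)%N; [exact: leq_addr|rewrite ft -addnS].
Qed.

(** If [alpha = A / B], then [B] times an error is an integer, so two successive errors smaller than
    [1 / B] vanish. Both vectors are then proportional to [(A, B)], against the determinant. *)
Lemma irrational_of_small (a q : nat -> int) alpha :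
  (forall n, `|a n * q n.+1 - a n.+1 * q n| = 1) ->
  (forall B : nat, exists n, B%:R * `|err alpha (a n) (q n)| < 1 /\
     B%:R * `|err alpha (a n.+1) (q n.+1)| < 1) ->
  irrational alpha.
Proof.
move=> det small /rationalP [A [B alphaE]].
(* Division by zero gives 0, so a zero denominator is replaced by the fraction 0 / 1. *)
wlog B0 : A B alphaE / (0 < B)%N.
  move=> H; case: B alphaE => [|B] alphaE; last exact: (H _ _ alphaE).
  by apply: (H 0 1%N) => //; rewrite alphaE invr0 mulr0 mul0r.
have BR : 0 < B%:R :> R by rewrite ltr0n.
have BalphaE : B%:R * alpha = A%:~R by rewrite alphaE mulrC divfK ?gt_eqF.
have [n [h0 h1]] := small B.
have zero m : B%:R * `|err alpha (a m) (q m)| < 1 -> B%:Z * a m - A * q m = 0.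
  move=> h; apply/eqP; apply: contraTT h => ne; rewrite -leNgt.
  rewrite -[X in X * _](gtr0_norm BR) -normrM.
  rewrite (_ : _ * err _ _ _ = (B%:Z * a m - A * q m)%:~R) ?intr_norm_ge1//.
  by rewrite /err mulrBr mulrA BalphaE intrB !intrM.
have z0 := zero _ h0; have z1 := zero _ h1.
have : B%:Z * (a n * q n.+1 - a n.+1 * q n) = 0.
  rewrite (_ : _ * _ = (B%:Z * a n - A * q n) * q n.+1 -
    (B%:Z * a n.+1 - A * q n.+1) * q n); last by ring.
  by rewrite z0 z1 !mul0r subrr.
move/eqP; rewrite mulf_eq0 => /orP[|/eqP d0]; first by rewrite eqz_nat gtn_eqF.
by have := det n; rewrite d0 normr0.
Qed.

(* Numerators (from 1, 0) and denominators (from 0, 1) of the convergents of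
   the continued fraction [0; 1, 2, 3, ...]. *)
Fixpoint cf_pair (x0 x1 : int) (n : nat) : int * int :=
  if n is m.+1 then
    ((cf_pair x0 x1 m).2, m.+1%:Z * (cf_pair x0 x1 m).2 + (cf_pair x0 x1 m).1)
  else (x0, x1).

Definition cf_seq x0 x1 n : int := (cf_pair x0 x1 n).1.

Lemma cf_seqSS x0 x1 n :
  cf_seq x0 x1 n.+2 = n.+1%:Z * cf_seq x0 x1 n.+1 + cf_seq x0 x1 n.
Proof. by []. Qed.

Lemma cf_seq_ge0 n : 0 <= cf_seq 0 1 n /\ 1 <= cf_seq 0 1 n.+1.
Proof. by elim: n => [//|n [h0 h1]]; rewrite cf_seqSS; split; nia. Qed.

Lemma cf_seq_bounds n : [/\ 0 < cf_seq 0 1 n.+1, n%:Z <= cf_seq 0 1 n.+1 &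
  n.+1%:Z * cf_seq 0 1 n.+1 <= cf_seq 0 1 n.+2].
Proof.
have [h0 h1] := cf_seq_ge0 n; rewrite cf_seqSS; split; [by lia| |by lia].
by case: n h0 h1 => [//|n] h0 h1; have := cf_seq_ge0 n; rewrite cf_seqSS; nia.
Qed.

Let A := cf_seq 1 0.
Let Q := cf_seq 0 1.

Let Q_gt0 n : 0 < Q n.+1. Proof. by have [] := cf_seq_bounds n. Qed.

Let det n : `|A n * Q n.+1 - A n.+1 * Q n| = 1.
Proof.
elim: n => [//|n IH]; rewrite -IH -normrN /A /Q !cf_seqSS -/A -/Q.
by congr (`| _ |); ring.
Qed.

(** The distance between convergents [n] and [n + j] with denominators cleared. As a function of [j]
    the difference obeys the recurrence of [Q], starting from 0 and a unit, so it grows no faster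
    than [Q (n + j)] divided by [Q n.+1]. *)
Let cross_le n j : `|Q n * A (n + j)%N - A n * Q (n + j)%N| * Q n.+1 <= Q (n + j)%N.
Proof.
have [H //] : `|Q n * A (n + j)%N - A n * Q (n + j)%N| * Q n.+1 <= Q (n + j)%N /\
  `|Q n * A (n + j).+1%N - A n * Q (n + j).+1%N| * Q n.+1 <= Q (n + j).+1%N.
elim: j => [|j [IH0 IH1]].
  rewrite addn0 [Q n * _]mulrC subrr normr0 mul0r; split; first by have [] := cf_seq_ge0 n.
  by rewrite distrC [Q n * _]mulrC det mul1r.
rewrite addnS; split => //.
rewrite {1 4}/Q {1}/A !cf_seqSS -/A -/Q.
have := Q_gt0 n; set m := (n + j)%N in IH0 IH1 *.
have -> : Q n * (m.+1%:Z * A m.+1 + A m) - A n * (m.+1%:Z * Q m.+1 + Q m) =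
  m.+1%:Z * (Q n * A m.+1 - A n * Q m.+1) + (Q n * A m - A n * Q m) by ring.
move: IH0 IH1; set x := Q n * A m - _; set y := Q n * A m.+1 - _ => IH0 IH1 q0.
have := ler_normD (m.+1%:Z * y) x; rewrite normrM (ger0_norm (_ : 0 <= m.+1%:Z))//.
by clear -IH0 IH1 q0; nia.
Qed.

Lemma cf_limit : exists alpha : R, irrational alpha /\
  forall n, (cf_seq 0 1 n.+2)%:~R * `|err alpha (cf_seq 1 0 n.+1) (cf_seq 0 1 n.+1)| <= 1.
Proof.
rewrite -/A -/Q.
have QR n : 0 < (Q n.+1)%:~R :> R by rewrite ltr0z.
have fracB (x y u v : R) : u != 0 -> v != 0 -> x / u - y / v = (v * x - y * u) / (v * u).
  by move=> u0 v0; field; rewrite u0 v0.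
pose c n : R := (A n.+1)%:~R / (Q n.+1)%:~R.
pose ep n : R := ((Q n.+1)%:~R * (Q n.+2)%:~R)^-1.
have ep_gt0 n : 0 < ep n by rewrite invr_gt0 mulr_gt0.
have close n j : `|c (n + j)%N - c n| <= ep n.
  rewrite (_ : _ - _ = (Q n.+1 * A (n + j).+1%N - A n.+1 * Q (n + j).+1%N)%:~R /
     ((Q n.+1)%:~R * (Q (n + j).+1%N)%:~R)); last first.
    by rewrite intrB !intrM; apply: fracB; rewrite gt_eqF.
  rewrite normrM normfV [X in _ / X]gtr0_norm ?mulr_gt0//.
  rewrite ler_pdivrMr ?mulr_gt0// /ep invfM mulrACA mulVf ?gt_eqF// mul1r [leRHS]mulrC.
  rewrite ler_pdivlMr// -intr_norm -intrM ler_int.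
  by have := cross_le n.+1 j; rewrite addSn.
have le_c i j : c i - ep i <= c j + ep j.
  have := ep_gt0 i; have := ep_gt0 j.
  have [ij|/ltnW ji] := leqP i j.
    by have := close i (j - i)%N; rewrite subnKC// ler_norml; lra.
  by have := close j (i - j)%N; rewrite subnKC// ler_norml; lra.
(* The intervals of radius [ep n] around [c n] meet pairwise, so the supremum of their left ends
   lies in all of them. *)
pose S : set R := range (fun n => c n - ep n).
have ubS n : ubound S (c n + ep n) by move=> _ [m _ <-]; apply: le_c.
pose alpha := sup S; exists alpha.
have al_ge n : c n - ep n <= alpha.
  by apply: ub_le_sup; [exists (c 0 + ep 0); exact: ubS|exists n].
have al_le n : alpha <= c n + ep n.
  by apply: ge_sup; [exists (c 0 - ep 0); exists 0|exact: ubS].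
have small n : (Q n.+2)%:~R * `|err alpha (A n.+1) (Q n.+1)| <= 1.
  have -> : err alpha (A n.+1) (Q n.+1) = (Q n.+1)%:~R * (c n - alpha).
    by rewrite mulrBr [_ * c n]mulrC divfK ?gt_eqF// [_ * alpha]mulrC.
  rewrite normrM (gtr0_norm (QR n)) mulrA -ler_pdivlMl ?mulr_gt0//.
  by rewrite mulr1 [_ * _]mulrC -/(ep n) ler_norml; have := al_ge n; have := al_le n; lra.
split=> //; apply: (irrational_of_small (a := A) (q := Q)) => // B.
have bd n : (B <= n)%N -> B%:R * `|err alpha (A n.+2) (Q n.+2)| < 1.
  move=> Bn; have := small n.+1; set E := `|_| => QE.
  have [E0|E0] := eqVneq E 0; first by rewrite E0 mulr0.
  apply: lt_le_trans QE; rewrite ltr_pM2r; last by rewrite lt_neqAle eq_sym E0 normr_ge0.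
  rewrite pmulrn ltr_int; apply: (@lt_le_trans _ _ n.+2%:Z); last by have [] := cf_seq_bounds n.+2.
  by lia.
by exists B.+2; split; apply: bd.
Qed.

End UpperBound.

(** * Numbers attaining the lower bounds *)

Section Attained.
Context {R : realType}.
Implicit Types (p : \bar R) (alpha t r e x y : R).

Let u0 : R := (Num.sqrt 5 + 5) / 10.

Lemma eventually_below_cf p alpha : (1 <= p)%E ->
  (forall n, (cf_seq 0 1 n.+2)%:~R * `|err alpha (cf_seq 1 0 n.+1) (cf_seq 0 1 n.+1)| <= 1) ->
  eventually_below p alpha 1.
Proof.
move=> p1 small e e0.
(* For [d <= 1] one has [(1 + d) ^ 2 <= 1 + 3 * d], which is below [1 + e] when [d <= e / 4]. *)
pose d : R := Num.min 1 (e / 4).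
have d0 : 0 < d by rewrite lt_min ltr01/=; lra.
have [d1 d2] : d <= 1 /\ d <= e / 4 by split; rewrite ge_min lexx ?orbT.
pose N := Num.trunc d^-1.
pose f n : R := (cf_seq 0 1 n.+1)%:~R.
have fR n : 0 < f n by have [h _ _] := cf_seq_bounds n; rewrite /f ltr0z.
exists (f N); split; first by rewrite num_real.
move=> t tN; have t0 : 0 < t by apply: lt_trans tN.
have tf : t < f (N + (Num.trunc t).+1)%N.
  apply: (lt_le_trans (truncnS_gt t)).
  have [_ h _] := cf_seq_bounds (N + (Num.trunc t).+1).
  rewrite pmulrn ler_int; apply: le_trans h; rewrite lez_nat; exact: leq_addl.
have [n Nn /andP[ft tf']] := bracket (ltW tN) tf.
exists (cf_seq 1 0 n.+1), (cf_seq 0 1 n.+1).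
have [q0 _ q2] := cf_seq_bounds n; split => //.
have := small n; set E := err _ _ _ => sm.
have h1 : `|t^-1 * f n| <= 1.
  by rewrite normrM (gtr0_norm (fR n)) gtr0_norm ?invr_gt0// mulrC ler_pdivrMr// mul1r.
have h2 : `|t * E| <= 1.
  rewrite normrM (gtr0_norm t0); apply: le_trans sm; rewrite ler_wpM2r//; exact: ltW.
(* The product of the coordinates does not depend on [t]. It is at most [1 / (n + 1)], because the
   next partial quotient is at least [n + 1]. *)
have h3 : `|t^-1 * f n| * `|t * E| <= d.
  rewrite -normrM (_ : t^-1 * f n * (t * E) = f n * E); last first.
    by field; rewrite gt_eqF.
  rewrite normrM (gtr0_norm (fR n)).
  have nR : d^-1 <= n.+1%:R.
    by apply: (le_trans (ltW (truncnS_gt _))); rewrite ler_nat.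
  have : n.+1%:R * f n <= f n.+1.
    by rewrite /f pmulrn -intrM ler_int.
  move=> /(ler_wpM2r (normr_ge0 E)) /le_trans /(_ sm) h.
  rewrite -[leRHS]mul1r -ler_pdivrMr//; apply: le_trans h.
  by rewrite -[leRHS]mulrA [leRHS]mulrC ler_wpM2l// mulr_ge0// ltW.
have N2 : approx_norm p alpha t (cf_seq 1 0 n.+1) (cf_seq 0 1 n.+1) <= 1 + d :=
  pnorm_le_thin p1 h1 h2 h3 d1.
have N0 : 0 <= approx_norm p alpha t (cf_seq 1 0 n.+1) (cf_seq 0 1 n.+1) :=
  pnorm_ge0 _ _.
move: N2 N0; set M := approx_norm _ _ _ _ _ => N2 N0.
by clear -N2 N0 d0 d1 d2 e0; nra.
Qed.

Let g : R := golden.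

Lemma golden_sqr : g ^+ 2 = 1 - g.
Proof.
have [s2 /andP[s_gt s_lt]] := @sqrt5_bounds R; rewrite /g /golden.
rewrite expr_div_n sqrrD s2; lra.
Qed.

Lemma golden_bounds : 1 / 2 < g < 2 / 3.
Proof.
have [s2 /andP[s_gt s_lt]] := @sqrt5_bounds R; rewrite /g /golden.
by apply/andP; split; lra.
Qed.

Let g_gt0 : 0 < g. Proof. by have /andP[? ?] := golden_bounds; lra. Qed.

Lemma golden_inv : g^-1 = 1 + g.
Proof.
apply: (mulfI (lt0r_neq0 g_gt0)); rewrite divff ?gt_eqF// mulrDr -expr2 golden_sqr; lra.
Qed.

Lemma golden_u0 : u0 = g^-1 / Num.sqrt 5.
Proof.
have [s2 /andP[s_gt s_lt]] := @sqrt5_bounds R.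
have s0 : Num.sqrt 5 != 0 :> R by rewrite gt_eqF//; lra.
apply: (mulIf s0); rewrite divfK// golden_inv /u0 /g /golden.
by rewrite mulrAC mulrDl -expr2 s2; lra.
Qed.

(** For a fixed product the norm is largest when the ratio of the coordinates is extreme, here
    [g^-1]. In terms of [r]-th powers this is [(F * b - a) * (F * a - b) >= 0], rearranged in
    [key]. *)
Lemma pnorm_golden_le p x y : (1 <= p)%E -> 0 < x -> 0 < y ->
  x * y = (Num.sqrt 5)^-1 -> x <= g^-1 * y -> y <= g^-1 * x ->
  pnorm p (x, y) ^+ 2 <= u0 * golden_factor p.
Proof.
move=> p1 x0 y0 xy hx hy.
have gV0 : 0 < g^-1 by rewrite invr_gt0.
have u0E : u0 = x * y * g^-1 by rewrite golden_u0 xy mulrC.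
case: p p1 => [r| |]; [| |by []]; last first.
  move=> _; rewrite /= mulr1 u0E (gtr0_norm x0) (gtr0_norm y0).
  have [_|_] := leP x y; rewrite expr2.
    by rewrite [x * y]mulrC -mulrA ler_wpM2l ?(ltW y0)// [x * _]mulrC.
  by rewrite -mulrA ler_wpM2l ?(ltW x0)// [y * _]mulrC.
rewrite lee_fin => r1; have r0 : 0 < r by lra.
rewrite /= (gtr0_norm x0) (gtr0_norm y0).
rewrite (_ : 2^-1 * (Num.sqrt 5 - 1) = g); last by rewrite /g /golden; lra.
set a := x `^ r; set b := y `^ r; set F := g^-1 `^ r.
have a0 : 0 < a by apply: powR_gt0.
have b0 : 0 < b by apply: powR_gt0.
have F0 : 0 < F by apply: powR_gt0.
have ha : a <= F * b.
  by rewrite -powRM ?(ltW y0) ?(ltW gV0)//; apply: ler_powR2; rewrite ?(ltW r0) ?(ltW x0).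
have hb : b <= F * a.
  by rewrite -powRM ?(ltW x0) ?(ltW gV0)//; apply: ler_powR2; rewrite ?(ltW r0) ?(ltW y0).
have gF : g `^ r * F = 1 by rewrite -powRM ?(ltW g_gt0) ?(ltW gV0)// divff ?gt_eqF// powR1.
set G := g `^ r in gF *.
have key : (a + b) ^+ 2 <= a * b * F * (G + 1) ^+ 2.
  rewrite -(ler_pM2r F0).
  rewrite [leRHS](_ : _ = a * b * (G * F + F) ^+ 2); last by ring.
  rewrite gF; have : 0 <= (F * b - a) * (F * a - b) by rewrite mulr_ge0 ?subr_ge0.
  clear; lra.
rewrite -powR_mulrn ?powR_ge0// -powRrM [r^-1 * _]mulrC.
have sqE (z : R) : 0 <= z -> z `^ (2 / r) = (z ^+ 2) `^ r^-1.
  by move=> z0; rewrite powRrM powR_mulrn.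
have G0 : 0 <= G + 1 by rewrite addr_ge0 ?powR_ge0.
rewrite (sqE _ G0) sqE ?addr_ge0 ?(ltW a0) ?(ltW b0)//.
have -> : u0 = (a * b * F) `^ r^-1.
  rewrite -!powRM ?mulr_ge0 ?(ltW x0) ?(ltW y0) ?(ltW gV0)//.
  by rewrite powRK ?gt_eqF ?mulr_ge0 ?(ltW x0) ?(ltW y0) ?(ltW gV0).
rewrite -powRM ?sqr_ge0//; last by rewrite !mulr_ge0 ?(ltW a0) ?(ltW b0) ?(ltW F0).
by apply: ler_powR2; rewrite ?invr_ge0 ?(ltW r0) ?sqr_ge0.
Qed.

Fixpoint fib_pair (n : nat) : int * int :=
  if n is m.+1 then ((fib_pair m).2, (fib_pair m).2 + (fib_pair m).1) else (0, 1).

Definition fib n : int := (fib_pair n).1.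

Lemma fibSS n : fib n.+2 = fib n.+1 + fib n.
Proof. by []. Qed.

Lemma fib_gt0 n : 0 < fib n.+1.
Proof.
suff [] : 0 <= fib n /\ 0 < fib n.+1 by [].
by elim: n => [//|n [h0 h1]]; rewrite fibSS; split; lia.
Qed.

(** [- g] is a root of [x ^ 2 = x + 1], so both sides satisfy the Fibonacci recurrence. *)
Lemma err_fib n : err g (fib n) (fib n.+1) = (- g) ^+ n.+1.
Proof.
suff [] : err g (fib n) (fib n.+1) = (- g) ^+ n.+1 /\
  err g (fib n.+1) (fib n.+2) = (- g) ^+ n.+2 by [].
elim: n => [|n [IH0 IH1]].
  split; first by rewrite /err expr1 /= mulr1 sub0r.
  by rewrite /err /= mulr1 sqrrN golden_sqr.
split => //; rewrite (fibSS n.+1) {1}(fibSS n).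
have := err_comb g (fib n.+1) (fib n.+2) (fib n) (fib n.+1) 1 1.
rewrite !mul1r => ->; rewrite IH0 IH1 !exprS.
have := golden_sqr; rewrite expr2 => g2.
rewrite (_ : - g * (- g * (- g * _)) = - (g * g) * (g * (- g) ^+ n)); last by ring.
by rewrite g2; ring.
Qed.

(** Binet's formula; [g^-1] and [- g] are the two roots of [x ^ 2 = x + 1]. *)
Lemma fib_binet n : Num.sqrt 5 * (fib n)%:~R = g^-1 ^+ n - (- g) ^+ n.
Proof.
suff [] : Num.sqrt 5 * (fib n)%:~R = g^-1 ^+ n - (- g) ^+ n /\
  Num.sqrt 5 * (fib n.+1)%:~R = g^-1 ^+ n.+1 - (- g) ^+ n.+1 by [].
rewrite golden_inv; elim: n => [|n [IH0 IH1]].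
  by split; rewrite /= ?mulr0 ?expr0 ?subrr// !expr1 mulr1 /g /golden; lra.
split => //; rewrite fibSS intrD mulrDr IH0 IH1 !exprS.
have := golden_sqr; rewrite expr2 => g2.
rewrite (_ : (1 + g) * ((1 + g) * _) = (1 + 2 * g + g * g) * (1 + g) ^+ n); last by ring.
rewrite (_ : - g * (- g * _) = g * g * (- g) ^+ n); last by ring.
by rewrite g2; ring.
Qed.

Lemma golden_inv_exp_ge n : 1 + n%:R / 2 <= g^-1 ^+ n.
Proof.
have /andP[g1 g2] := golden_bounds.
elim: n => [|n IH]; first by rewrite mul0r addr0 expr0.
rewrite exprS golden_inv in IH *; apply: (@le_trans _ _ ((1 + g) * (1 + n%:R / 2))).
  rewrite -natr1; have := ler0n R n; nra.
by rewrite ler_wpM2l//; lra.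
Qed.

Lemma golden_irrational : irrational g.
Proof.
have /andP[g1 g2] := golden_bounds.
apply: (irrational_of_small (a := fib) (q := fun n => fib n.+1)) => [n|B].
  elim: n => [//|n IH]; rewrite -IH -normrN !fibSS; congr (`| _ |); ring.
have bd n : (B.*2 <= n)%N -> B%:R * `|err g (fib n) (fib n.+1)| < 1.
  move=> Bn; rewrite err_fib normrX normrN (gtr0_norm g_gt0).
  rewrite -[g ^+ _]invrK -exprVn ltr_pdivrMr ?exprn_gt0 ?invr_gt0// mul1r.
  apply: lt_le_trans (golden_inv_exp_ge _).
  have : B.*2%:R <= n%:R :> R by rewrite ler_nat.
  rewrite -muln2 natrM -[n.+1%:R]natr1; lra.
by exists B.*2; split; apply: bd.
Qed.

(** Up to a factor [1 + d] the rescaled Fibonacci vector is bounded by [(x, y)] with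
    [x * y = 1 / sqrt 5]. The index [n] is chosen from [t] so that [y / x] lies between [g] and
    [g^-1], and [pnorm_golden_le] applies. *)
Lemma eventually_below_golden p : (1 <= p)%E ->
  eventually_below p g (u0 * golden_factor p).
Proof.
move=> p1 e e0.
have /andP[g1 g2] := golden_bounds.
have [s2 /andP[s_gt s_lt]] := @sqrt5_bounds R.
set s := Num.sqrt 5 in s2 s_gt s_lt *.
set K := u0 * golden_factor p.
have gV1 : 1 < g^-1 by rewrite golden_inv; lra.
have gV0 : 0 < g^-1 by lra.
have K0 : 0 <= K.
  rewrite mulr_ge0//; first by rewrite /u0 -/s; lra.
  by clear -p1; case: p p1 => [r| |] //= _; rewrite powR_ge0.
pose d : R := Num.min 1 (e / (4 * (K + 1))).
have d0 : 0 < d by rewrite lt_min ltr01/= divr_gt0//; lra.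
have [d1 d2] : d <= 1 /\ d * (4 * (K + 1)) <= e.
  split; first by rewrite ge_min lexx.
  by rewrite -ler_pdivlMr; [rewrite ge_min lexx orbT|lra].
(* Doubled because [golden_inv_exp_ge] grows with slope 1/2; it yields [P^-1 <= d] below. *)
pose N := (Num.trunc d^-1).*2.
pose f n : R := g^-1 ^+ n.*2.+1.
exists (f N + 1); split; first by rewrite num_real.
move=> t tN; have f0 n : 0 < f n by rewrite exprn_gt0.
have t1 : 1 < t by have := f0 N; lra.
have t0 : 0 < t by lra.
(* Since [y / x = z / P ^ 2] and [P ^ 2 = g^-1 ^ (2 * n + 2)], bracketing [z] between consecutive
   odd powers of [g^-1] bounds the ratio on both sides. *)
pose z := s * t ^+ 2.
have fz : f N <= z.
  have : t <= z by rewrite /z; nra.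
  lra.
have zf : z < f (N + (Num.trunc z).+1)%N.
  apply: (lt_le_trans (truncnS_gt z)).
  apply: le_trans (golden_inv_exp_ge _).
  have : ((Num.trunc z).+1.*2%:R : R) <= (N + (Num.trunc z).+1).*2.+1%:R.
    by rewrite ler_nat leqW// leq_double leq_addl.
  rewrite -muln2 natrM; lra.
have [n Nn /andP[fn nf]] := bracket fz zf.
exists (fib n), (fib n.+1); split; first exact: fib_gt0.
set P := g^-1 ^+ n.+1.
have P0 : 0 < P by rewrite exprn_gt0.
have P2 : P ^+ 2 = g^-1 * f n by rewrite -exprM muln2 doubleS -exprS.
have fP : f n.+1 = g^-1 * P ^+ 2 by rewrite -exprM muln2 -exprS.
have PV : g ^+ n.+1 = P^-1 by rewrite /P exprVn invrK.
have Pd : d^-1 <= P.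
  apply: le_trans (golden_inv_exp_ge _); apply: (le_trans (ltW (truncnS_gt _))).
  have : (N%:R : R) <= n.+1%:R by rewrite ler_nat ltnW.
  rewrite /N -muln2 natrM -[(Num.trunc _).+1%:R]natr1; lra.
have PVd : P^-1 <= d by rewrite -[leRHS]invrK lef_pV2// posrE ?invr_gt0.
pose x := P / (s * t); pose y := t / P.
have s_gt0 : 0 < s by lra.
have x0 : 0 < x by rewrite divr_gt0// mulr_gt0.
have y0 : 0 < y by rewrite divr_gt0.
have xy : x * y = s^-1 by rewrite /x /y; field; rewrite !gt_eqF.
have hx : x <= g^-1 * y.
  rewrite /x /y ler_pdivrMr ?mulr_gt0//.
  rewrite (_ : g^-1 * _ * _ = g^-1 * z / P); last by rewrite /z; ring.
  by rewrite ler_pdivlMr// -expr2 P2 ler_wpM2l// ltW.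
have hy : y <= g^-1 * x.
  rewrite /x /y ler_pdivrMr//.
  rewrite (_ : g^-1 * _ * _ = g^-1 * P ^+ 2 / (s * t)); last by ring.
  rewrite ler_pdivlMr ?mulr_gt0// (_ : t * _ = z); last by rewrite /z; ring.
  by rewrite -fP ltW.
have d1_gt0 : 0 < 1 + d by lra.
have dx : 0 < (1 + d) * x by rewrite mulr_gt0.
have dy : 0 < (1 + d) * y by rewrite mulr_gt0.
have le1 : `|t^-1 * (fib n.+1)%:~R| <= `|(1 + d) * x|.
  have tq : 0 < t^-1 * (fib n.+1)%:~R by rewrite mulr_gt0 ?invr_gt0 ?ltr0z ?fib_gt0.
  rewrite (gtr0_norm tq) (gtr0_norm dx).
  rewrite -(ler_pM2l (mulr_gt0 s_gt0 t0)).
  rewrite (_ : _ * (t^-1 * _) = s * (fib n.+1)%:~R); last by field; rewrite gt_eqF.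
  rewrite (_ : _ * ((1 + d) * x) = (1 + d) * P); last by rewrite /x; field; rewrite !gt_eqF.
  rewrite fib_binet -/P mulrDl mul1r lerD2l.
  (* The factor [1 + d] absorbs the second term of Binet's formula. *)
  have : `|(- g) ^+ n.+1| <= d * P.
    rewrite normrX normrN (gtr0_norm g_gt0) PV; apply: (le_trans PVd).
    by rewrite ler_peMr ?(ltW d0)//; apply: (le_trans _ Pd); rewrite -[leLHS]invr1 lef_pV2// posrE.
  by rewrite ler_norml; lra.
have le2 : `|t * err g (fib n) (fib n.+1)| <= `|(1 + d) * y|.
  rewrite err_fib normrM normrX normrN (gtr0_norm g_gt0) PV (gtr0_norm t0).
  rewrite (gtr0_norm dy).
  by rewrite -/y ler_peMl ?(ltW y0)//; lra.
have N1 : approx_norm p g t (fib n) (fib n.+1) <= (1 + d) * pnorm p (x, y).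
  rewrite -pnormZ//; last by lra.
  by apply: le_pnorm.
have N2 := pnorm_golden_le p1 x0 y0 xy hx hy.
have N0 : 0 <= approx_norm p g t (fib n) (fib n.+1) := pnorm_ge0 _ _.
have N0' : 0 <= pnorm p (x, y) := pnorm_ge0 _ _.
have h1 : approx_norm p g t (fib n) (fib n.+1) ^+ 2 <= ((1 + d) * pnorm p (x, y)) ^+ 2.
  by rewrite ler_pXn2r ?nnegrE// mulr_ge0//; lra.
apply: (le_lt_trans h1); rewrite exprMn.
have h2 : (1 + d) ^+ 2 * pnorm p (x, y) ^+ 2 <= (1 + d) ^+ 2 * K.
  by rewrite ler_wpM2l// sqr_ge0.
apply: (le_lt_trans h2).
by clear -d0 d1 d2 K0 e0; nra.
Qed.

End Attained.

Theorem theorem4 (R : realType) (p : \bar R) (p_ge1 : (1%:E <= p)%E) :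
  ((p <= 2%:E)%E ->
     is_minimum [set delta p alpha | alpha in @irrational R] (Delta p)) /\
  ((2%:E < p)%E ->
     is_minimum [set delta p alpha | alpha in @irrational R]
       (Delta p / 10 * (Num.sqrt 5 + 5) * golden_factor p) /\
     delta p golden = Delta p / 10 * (Num.sqrt 5 + 5) * golden_factor p).
Proof.
split=> [p_le2|p_gt2].
  have lower alpha : irrational alpha -> Delta p <= delta p alpha.
    move=> irr; rewrite -[leLHS]mulr1; apply: delta_ge (eventually_below4 p_ge1 irr) _.
    exact: frequently_above_le2.
  have [alpha [irr small]] := @cf_limit R.
  split=> [|_ [beta irr_beta <-]]; last exact: lower.
  exists alpha => //; apply/eqP; rewrite eq_le lower// andbT -[leRHS]mulr1.
  exact: delta_le (eventually_below_cf p_ge1 small).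
have -> : Delta p / 10 * (Num.sqrt 5 + 5) * golden_factor p =
    Delta p * ((Num.sqrt 5 + 5) / 10 * golden_factor p) by ring.
have lower alpha : irrational alpha ->
    Delta p * ((Num.sqrt 5 + 5) / 10 * golden_factor p) <= delta p alpha.
  move=> irr; apply: delta_ge (eventually_below4 p_ge1 irr) _.
  exact: frequently_above_gt2.
have golden_min : delta p golden = Delta p * ((Num.sqrt 5 + 5) / 10 * golden_factor p).
  apply/eqP; rewrite eq_le lower ?andbT; last exact: golden_irrational.
  exact: delta_le (eventually_below_golden p_ge1).
split => //; split=> [|_ [beta irr_beta <-]]; last exact: lower.
by exists golden => //; exact: golden_irrational.
Qed.
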